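(* Let $\dim V\ge 4$ and fix $J\in\mathcal{T}(V,g)$. Let $QS\in\Gamma(\mathfrak{gl}(\mathbb{V}))$ be such that $Q=a_{k}\{J,\phi\}^{k}+\dots+a_{1}\{J,\phi\}+a_{0}\mathbb{1}$ with $a_{i}\in C^{\infty}(\mathcal{T})$, and $S\in\{\mathbb{1},\,J+\phi,\,J-\phi,\,[J,\phi]\}$. 1) $\mathcal{D}^{QS}$ is integrable if, for every $i$, $d{a_{i}}_{B}=0$ for all $B\in\mathcal{D}^{S}$. 2) $\mathcal{D}^{QS}_{\mathfrak{u}(J)}$ is integrable if, for every $i$, $d{a_{i}}_{C}=0$ for all $C\in\mathcal{D}^{S}_{\mathfrak{u}(J)}$.
   Context: $(V,g)$ is a $2n$-dimensional real vector space with a positive definite metric. $\mathcal{T}=\mathcal{T}(V,g)=\{K\in \mathrm{End}V : K^{2}=-1,\ g(K\cdot,K\cdot)=g(\cdot,\cdot)\}$, a submanifold of $\mathrm{End}V$. $\mathbb{V}=V\times\mathcal{T}$, $\mathfrak{gl}(\mathbb{V})=\mathrm{End}V\times\mathcal{T}$. $\phi$ is the section with $\phi|_K=K$; $J$ and $\mathbb{1}$ are regarded as constant sections. $[A,B]=AB-BA$, $\{A,B\}=AB+BA$. $\mathfrak{o}_{\{\phi\}}$ is the bundle over $\mathcal{T}$ with fiber $\{A\in\mathfrak{o}(V,g):AK+KA=0\}$ at $K$; it is identified with $T\mathcal{T}$. $\mathfrak{u}(V,J)=\{A\in\mathfrak{o}(V,g):[A,J]=0\}$. $da_X$ is the derivative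 of the function $a$ in direction $X\in T\mathcal{T}$. The distributions on $\mathcal{T}$ are defined pointwise (everything evaluated at $K\in\mathcal{T}$) by $$\mathcal{D}^{QS}=\{B\in\mathfrak{o}_{\{\phi\}} \ |\ B:\mathrm{Ker}QS\to 0,\ \mathrm{Im}QS\to\mathrm{Im}QS\},$$ $$\mathcal{D}^{QS}_{\mathfrak{u}(J)}=\{[B,\phi]\in\mathfrak{o}_{\{\phi\}} \ |\ B\in\mathfrak{u}(V,J),\ B:\mathrm{Ker}QS\to 0,\ \mathrm{Im}QS\to\mathrm{Im}QS\},$$ and $\mathcal{D}^{S}$, $\mathcal{D}^{S}_{\mathfrak{u}(J)}$ denote the case $Q=\mathbb{1}$. Integrability is in the generalized sense (rank may vary): through each point of $\mathcal{T}$ passes an integral submanifold, i.e. one whose tangent space at each of its points equals the distribution there. *)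

(* Defs.v *)
From HB Require Import structures.
From mathcomp Require Import all_boot all_order all_algebra.
From mathcomp Require Import sesquilinear.
From mathcomp Require Import mathcomp_extra boolp classical_sets functions reals.
From mathcomp Require Import topology normedtype landau derive.

Set Implicit Arguments.
Unset Strict Implicit.
Unset Printing Implicit Defensive.

Import Order.TTheory GRing.Theory Num.Theory.
Import numFieldNormedType.Exports.
Import passmx.

Local Open Scope classical_set_scope.
Local Open Scope ring_scope.

(* 'Hom(V, W) as a normed space.  All norms on a finite-dimensional real vector
   space are equivalent, so the choice made here (largest absolute value of the
   matrix entries in the bases vbasis) affects neither the topology nor
   differentiability. *)
Section HomNorm.
Context {R : realType} {V W : vectType R}.

Definition hom_norm (A : 'Hom(V, W)) : R :=
  `| mxof (vbasis {:V}) (vbasis {:W}) A |.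

Lemma hom_normD A B : hom_norm (A + B) <= hom_norm A + hom_norm B.
Proof. by rewrite /hom_norm linearD ler_normD. Qed.

Lemma hom_normZ (l : R) A : hom_norm (l *: A) = `|l| * hom_norm A.
Proof. by rewrite /hom_norm linearZ normrZ. Qed.

Lemma hom_norm0_eq0 A : hom_norm A = 0 -> A = 0.
Proof.
move=> /normr0_eq0 A0; apply: (can_inj (mxofK (vbasisP _) (vbasisP _))).
by rewrite A0 linear0.
Qed.

HB.instance Definition _ := Lmodule_isNormed.Build R 'Hom(V, W)
  hom_normD hom_normZ hom_norm0_eq0.

End HomNorm.

Section Smooth.
Context {R : realType} {E F : normedModType R}.

(* f is C^k on the open set U.  E is meant to be finite-dimensional: there, f is
   C^(k+1) iff it is differentiable and, for each fixed v, x |-> 'd f x v is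
   C^k. *)
Fixpoint Ck (k : nat) (U : set E) (f : E -> F) : Prop :=
  match k with
  | 0 => forall x, U x -> {for x, continuous f}
  | k'.+1 => (forall x, U x -> differentiable f x) /\
             (forall v, Ck k' U (fun x => 'd f x v))
  end.

Definition smooth_on (U : set E) (f : E -> F) : Prop := forall k, Ck k U f.

End Smooth.

Section Submanifold.
Context {R : realType} {E : normedModType R}.
Implicit Types (M N : set E) (D : E -> set E).

(* f, restricted to U, is a smooth immersion and a homeomorphism onto a
   relatively open subset of N. *)
Definition local_param (N : set E) (d : nat) (U : set 'rV[R]_d)
    (f : 'rV[R]_d -> E) : Prop :=
  [/\ open U,
      smooth_on U f,
      forall u, U u -> injective ('d f u),
      exists2 O : set E, open O & f @` U = N `&` O
    & exists2 h : E -> 'rV[R]_d,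
        forall u, U u -> h (f u) = u & {within f @` U, continuous h}].

Definition submanifold (d : nat) (N : set E) : Prop :=
  forall x, N x -> exists U f, @local_param N d U f /\ (f @` U) x.

Definition curve_through (N : set E) (x v : E) (c : R -> E) : Prop :=
  exists2 e : R, 0 < e &
    [/\ smooth_on (ball (0 : R) e) c,
        forall t, ball (0 : R) e t -> N (c t),
        c 0 = x & is_derive (0 : R) (1 : R) c v].

Definition tangent (N : set E) (x : E) : set E :=
  [set v | exists c, curve_through N x v c].

(* C^oo(N): only the values of a on N matter. *)
Definition smooth_fun (N : set E) (a : E -> R) : Prop :=
  forall x, N x -> exists (U : set E) (F : E -> R),
    [/\ open U, U x, smooth_on U F & forall y, N y -> U y -> F y = a y].

(* da_v = l at x, for v tangent to N at x. *)
Definition dir_deriv (N : set E) (a : E -> R) (x v : E) (l : R) : Prop :=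
  exists2 c : R -> E, curve_through N x v c &
    is_derive (0 : R) (1 : R) (a \o c) l.

(* The rank of D may vary, so the dimension d depends on the point.  A maximal
   integral submanifold may be only immersed, but each of its points has a
   neighbourhood in it that is embedded, so asking for embedded integral
   submanifolds through each point is no restriction. *)
Definition integral_submanifold M D (N : set E) : Prop :=
  [/\ N `<=` M, exists d, submanifold d N
    & forall x, N x -> tangent N x = D x].

Definition integrable M D : Prop :=
  forall x, M x -> exists2 N, N x & integral_submanifold M D N.

End Submanifold.

Section ComplexStructures.
Context {R : realType} {V : vectType R}.
Implicit Types (g : {dot V for idfun}) (A B C J K M : 'End(V)).

Definition comm_end A B : 'End(V) := (A \o B)%VF - (B \o A)%VF.
Definition anticomm_end A B : 'End(V) := (A \o B)%VF + (B \o A)%VF.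
Definition exp_end A (i : nat) : 'End(V) := iter i (comp_lfun A) \1%VF.

Definition twistor g : set 'End(V) :=
  [set K | (K \o K)%VF = - \1%VF /\ forall x y, g (K x) (K y) = g x y].

Definition so_end g : set 'End(V) :=
  [set A | forall x y, g (A x) y = - g x (A y)].

(* o_{phi} at K, identified with the tangent space of twistor g at K *)
Definition so_anti g K : set 'End(V) :=
  [set A | so_end g A /\ anticomm_end A K = 0].

Definition u_end g J : set 'End(V) :=
  [set A | so_end g A /\ comm_end A J = 0].

(* B : Ker M -> 0, Im M -> Im M *)
Definition supported_on M B : Prop :=
  (B @: lker M = 0)%VS /\ (B @: limg M <= limg M)%VS.

Definition dist g (M : 'End(V) -> 'End(V)) K : set 'End(V) :=
  [set B | so_anti g K B /\ supported_on (M K) B].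

Definition dist_u g J (M : 'End(V) -> 'End(V)) K : set 'End(V) :=
  [set C | exists B, [/\ C = comm_end B K, so_anti g K C,
                         u_end g J B & supported_on (M K) B]].

End ComplexStructures.

(* Main.v *)
Require Import Defs.
From HB Require Import structures.
From mathcomp Require Import all_boot all_order all_algebra.
From mathcomp Require Import ring lra.
From mathcomp Require Import sesquilinear.
From mathcomp Require Import mathcomp_extra boolp classical_sets functions reals.
From mathcomp Require Import interval_inference topology normedtype landau derive.

Set Implicit Arguments.
Unset Strict Implicit.
Unset Printing Implicit Defensive.

Import Order.TTheory GRing.Theory Num.Theory.
Import numFieldNormedType.Exports.
Import passmx.

Local Open Scope classical_set_scope.
Local Open Scope ring_scope.

(** Fix a point [K0] and let [W] be the image of [QS] at [K0].  Since [Q] is a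
    polynomial in the symmetric endomorphism [{J, K}], which commutes with [J]
    and [K], and [S] is symmetric or skew, [QS] has image orthogonal to its
    kernel, and both are stable under [J] and [K0].  Let [P] be the projection
    onto [W] along the kernel.

    A skew endomorphism that anticommutes with [K] is a bracket [[B, K]] with
    [B] skew ([dist_bracketE]), so both distributions consist of the brackets
    [[B, K]] with [B] in a Lie algebra of skew endomorphisms supported on [W],
    commuting with [J] in the second case.  The leaf through [K0] is therefore
    the orbit of [K0] under conjugation by the corresponding group, provided
    that the image and the kernel of [QS] stay the same along it.

    They do near [K0] ([section_end_stable]).  On the orbit, [K] commutes with
    [P] and agrees with [K0] on the kernel of [P]; so, as long as the
    coefficients [a_i] keep their values at [K0], [QS] still vanishes on the
    kernel of [P] and still maps [W] to [W], bijectively because invertibility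
    is an open condition.  The same argument shows that [W] is contained in the
    image of [S], so the velocities of the orbit lie in the distribution of
    [S], along which the [a_i] have zero derivative: the coefficients are
    indeed constant ([dir_deriv0_cst]).

    An integral submanifold is any submanifold with the right tangent spaces,
    so a small piece of the orbit is enough.  It is parametrized by
    [c(X) K0 c(X)^-1], where [c(X) = (1 + X) (1 - X)^-1] is the Cayley
    transform and [X] ranges over a complement, in the Lie algebra, of the
    elements commuting with [K0].  The resolvent of a skew endomorphism always
    exists and its differential is explicit ([is_diff_resolvent]), whence the
    differential of the parametrization, again a bracket
    ([is_diff_cayley_orbit]).  It is injective at the origin, hence the
    parametrization expands distances up to a constant near the origin
    ([immersion_expands]); this alone makes the image of a small ball an
    embedded submanifold with the expected tangent spaces
    ([embedded_ball_submanifold], [embedded_ball_tangent]).  These tangent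
    spaces consist of values of the distribution and exhaust them by a
    dimension count: conjugation carries the distribution at [K0] onto the
    distribution at the other points. *)

(** * Smooth maps between normed spaces *)

Section SmoothCalculus.
Context {R : realType}.

Lemma lipschitz_linear_continuous (E F : normedModType R) (L : {linear E -> F})
    (C : R) : (forall x, `|L x| <= C * `|x|) -> continuous L.
Proof.
move=> LC; apply/linear_bounded_continuous/bounded_funP => r.
exists (`|C| * r) => x xr; apply: le_trans (LC x) _.
apply: le_trans (ler_wpM2r (normr_ge0 x) (ler_norm C)) _.
by rewrite ler_wpM2l.
Qed.

Lemma is_diff_quadratic (E F : normedModType R) (f : E -> F)
    (L : {linear E -> F}) (x : E) (e C : R) : 0 < e -> continuous L ->
  (forall h, `|h| < e -> `|f (h + x) - f x - L h| <= C * `|h| ^+ 2) ->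
  is_diff x f L.
Proof.
move=> e0 Lc H.
have fE : f \o shift x = cst (f x) + L +o_ 0 id.
  apply/eqaddoP => _/posnumP[d]; near=> h.
  have -> : (f \o shift x - (cst (f x) + L)) h = f (h + x) - f x - L h.
    by rewrite /= !fctE /cst opprD addrA.
  apply: le_trans (H h _) _.
    near: h; apply/nbhs_norm0P; exists e => //.
  rewrite expr2 mulrA ler_wpM2r //.
  apply: le_trans (ler_wpM2r (normr_ge0 h) (ler_norm C)) _.
  have C1 : 0 < `|C| + 1 by rewrite ltr_wpDl.
  have : `|h| <= d%:num / (`|C| + 1).
    near: h; apply/nbhs_norm0P; exists (d%:num / (`|C| + 1)) => /=.
      by rewrite divr_gt0.
    by move=> y /= /ltW.
  rewrite ler_pdivlMr // mulrC; apply: le_trans.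
  by rewrite ler_wpM2r // lerDl.
have dE := diff_unique Lc fE.
apply: DiffDef; last exact: dE.
by apply/diff_locallyP; rewrite dE.
Unshelve. all: by end_near. Qed.

Lemma is_diff_bilinear (E F1 F2 G : normedModType R)
    (B : {bilinear F1 -> F2 -> G}) (f df : E -> F1) (g dg : E -> F2) (x : E) :
  continuous (fun p => B p.1 p.2) -> is_diff x f df -> is_diff x g dg ->
  is_diff x (fun y => B (f y) (g y)) (fun v => B (f x) (dg v) + B (df v) (g x)).
Proof.
move=> Bc df_ dg_.
have dB : is_diff (f x, g x) (fun q => B q.1 q.2)
    (fun q => B (f x) q.2 + B q.1 (g x)).
  by apply: DiffDef; [exact: differentiable_bilin | rewrite diff_bilin].
exact: (is_diff_comp (is_diff_pair df_ dg_) dB).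
Qed.

(** Differentiability gives continuity, so the recursive definition of
    [Ck] is monotone. *)
Lemma Ck_pred (E F : normedModType R) k (U : set E) (f : E -> F) :
  Ck k.+1 U f -> Ck k U f.
Proof.
elim: k f => [|k IH] f [fd dfk].
  by move=> x Ux; apply: differentiable_continuous; exact: fd.
by split => // v; apply: IH; exact: dfk.
Qed.

Lemma Ck_sub (E F : normedModType R) k (U U' : set E) (f : E -> F) :
  U' `<=` U -> Ck k U f -> Ck k U' f.
Proof.
move=> sU; elim: k f => [|k IH] f; first by move=> fc x /sU; exact: fc.
by move=> [fd dfk]; split=> [x /sU|v]; [exact: fd | exact/IH/dfk].
Qed.

Lemma Ck_cst (E F : normedModType R) k (U : set E) (c : F) :
  Ck k U (fun _ : E => c).
Proof.
elim: k c => [|k IH] c; first by move=> x _; exact: cst_continuous.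
split=> [x _|v]; first exact: differentiable_cst.
by under eq_fun do rewrite (diff_cst (V := E) c); exact: IH.
Qed.

(** The closure rules are stated on the whole space: there an equality
    between differentials is an equality of functions, which can be rewritten
    under [Ck]. *)
Lemma Ck_add (E F : normedModType R) k (f g : E -> F) :
  Ck k setT f -> Ck k setT g -> Ck k setT (fun x => f x + g x).
Proof.
elim: k f g => [|k IH] f g.
  by move=> fc gc x _; apply: continuousD; [exact: fc | exact: gc].
move=> [fd dfk] [gd dgk]; split=> [x _|v].
  by apply: differentiableD; [exact: fd | exact: gd].
have -> : (fun x => 'd (fun x => f x + g x) x v)
        = (fun x => 'd f x v + 'd g x v).
  apply/funext => x.
  by rewrite (_ : (fun x => f x + g x) = f + g) // diffD //; [exact: fd|exact: gd].
exact: (IH _ _ (dfk v) (dgk v)).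
Qed.

Lemma Ck_bilinear (E F1 F2 G : normedModType R)
    (B : {bilinear F1 -> F2 -> G}) k (f : E -> F1) (g : E -> F2) :
  continuous (fun p => B p.1 p.2) -> Ck k setT f -> Ck k setT g ->
  Ck k setT (fun x => B (f x) (g x)).
Proof.
move=> Bc; elim: k f g => [|k IH] f g.
  move=> fc gc x _.
  apply: (@continuous_comp _ _ _ (fun x => (f x, g x)) (fun p => B p.1 p.2)).
    by apply: cvg_pair; [exact: fc | exact: gc].
  exact: Bc.
move=> [fd dfk] [gd dgk].
have dB x : is_diff x (fun y => B (f y) (g y))
    (fun v => B (f x) ('d g x v) + B ('d f x v) (g x)).
  apply: is_diff_bilinear => //; apply: differentiableP; [exact: fd|exact: gd].
split=> [x _|v]; first exact: (@ex_diff _ _ _ _ _ _ _ (dB x)).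
have -> : (fun x => 'd (fun y => B (f y) (g y)) x v)
        = (fun x => B (f x) ('d g x v) + B ('d f x v) (g x)).
  by apply/funext => x; rewrite (@diff_val _ _ _ _ _ _ _ (dB x)).
by apply: Ck_add; apply: IH; [exact: Ck_pred (conj fd dfk) | exact: dgk v
  | exact: dfk v | exact: Ck_pred (conj gd dgk)].
Qed.

Lemma is_diff_line (E : normedModType R) (u w : E) (t : R) :
  is_diff t (fun s : R => u + s *: w) (fun s : R => s *: w).
Proof.
have -> : (fun s : R => u + s *: w) = cst u + (fun s : R => s *: w) by [].
by apply: is_diff_eq; rewrite add0r.
Qed.

Lemma Ck_line (E F : normedModType R) k (f : E -> F) (u w : E) :
  Ck k setT f -> Ck k setT (fun t : R => f (u + t *: w)).
Proof.
elim: k f => [|k IH] f.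
  move=> fc t _; apply: (@continuous_comp _ _ _ (fun s : R => u + s *: w) f).
    apply: differentiable_continuous.
    exact: (@ex_diff _ _ _ _ _ _ _ (is_diff_line _ _ _)).
  exact: fc.
move=> [fd dfk].
have df t : is_diff t (fun t : R => f (u + t *: w))
    (fun s => 'd f (u + t *: w) (s *: w)).
  apply: (is_diff_comp (is_diff_line u w t)).
  by apply: differentiableP; exact: fd.
split=> [t _|s]; first exact: (@ex_diff _ _ _ _ _ _ _ (df t)).
have -> : (fun t => 'd (fun t : R => f (u + t *: w)) t s)
        = (fun t => 'd f (u + t *: w) (s *: w)).
  by apply/funext => t; rewrite (@diff_val _ _ _ _ _ _ _ (df t)).
exact: (IH (fun x => 'd f x (s *: w)) (dfk _)).
Qed.

End SmoothCalculus.

(** * Endomorphisms as a normed algebra *)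

Section FiniteDimension.
Context {R : realType}.

Lemma ler_mx_norm_entry m n (A : 'M[R]_(m, n)) i j : `|A i j| <= `|A|.
Proof.
rewrite [leRHS]mx_normrE.
exact: (le_bigmax _ (fun ij => `|A ij.1 ij.2|) (i, j)).
Qed.

Lemma mx_norm_le m n (A : 'M[R]_(m, n)) (C : R) : 0 <= C ->
  (forall i j, `|A i j| <= C) -> `|A| <= C.
Proof.
by move=> C0 AC; rewrite [leLHS]mx_normrE; apply: bigmax_le => // ij _.
Qed.

Lemma mulmx_norm_le m n p (A : 'M[R]_(m, n)) (B : 'M[R]_(n, p)) :
  `|A *m B| <= n%:R * `|A| * `|B|.
Proof.
apply: mx_norm_le => [|i j]; first by rewrite !mulr_ge0.
rewrite mxE; apply: le_trans (ler_norm_sum _ _ _) _.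
have -> : n%:R * `|A| * `|B| = \sum_(k < n) `|A| * `|B|.
  by rewrite sumr_const card_ord -mulrA mulr_natl.
by apply: ler_sum => k _; rewrite normrM ler_pM // ler_mx_norm_entry.
Qed.

Lemma mx_linear_lipschitz m n (F : normedModType R)
    (L : {linear 'M[R]_(m, n) -> F}) : exists C, forall A, `|L A| <= C * `|A|.
Proof.
exists (\sum_i \sum_j `|L (delta_mx i j)|) => A.
rewrite {1}(matrix_sum_delta A) linear_sum mulr_suml.
apply: le_trans (ler_norm_sum _ _ _) _; apply: ler_sum => i _.
rewrite linear_sum mulr_suml.
apply: le_trans (ler_norm_sum _ _ _) _; apply: ler_sum => j _.
by rewrite linearZ normrZ mulrC ler_wpM2l // ler_mx_norm_entry.
Qed.

Lemma mx_linear_continuous m n (F : normedModType R)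
    (L : {linear 'M[R]_(m, n) -> F}) : continuous L.
Proof.
by have [C LC] := mx_linear_lipschitz L; exact: lipschitz_linear_continuous LC.
Qed.

Context {V : vectType R}.

Lemma hom_linear_continuous (F : normedModType R) (L : {linear 'End(V) -> F}) :
  continuous L.
Proof.
have [C LC] := mx_linear_lipschitz (L \o hommx (vbasis {:V}) (vbasis {:V})).
apply: (@lipschitz_linear_continuous _ _ _ _ C) => A.
by have := LC (mxof (vbasis {:V}) (vbasis {:V}) A);
   rewrite /= mxofK // ?vbasisP.
Qed.

Lemma comp_lfun_norm_le (A B : 'End(V)) :
  `|(A \o B)%VF| <= (\dim {:V})%:R * `|A| * `|B|.
Proof.
rewrite [leLHS]/(hom_norm _) /hom_norm (mxof_comp _ _ (vbasisP {:V})) mulrAC.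
exact: mulmx_norm_le.
Qed.

Lemma comp_lfun_bilinear :
  bilinear_for
    (GRing.Scale.Law.clone _ _ *:%R _) (GRing.Scale.Law.clone _ _ *:%R _)
    (@comp_lfun R V V V).
Proof.
split=> [u' | u] a x y /=.
- by rewrite comp_lfunDl comp_lfunZl.
- by rewrite comp_lfunDr comp_lfunZr.
Qed.

HB.instance Definition _ := bilinear_isBilinear.Build R 'End(V) 'End(V) 'End(V)
  _ _ (@comp_lfun R V V V) comp_lfun_bilinear.

(** [AB - A0 B0 = (A - A0) B + A0 (B - B0)] *)
Lemma comp_lfun_continuous :
  continuous (fun p : 'End(V) * 'End(V) => (p.1 \o p.2)%VF).
Proof.
move=> [A B]; apply/subr_cvg0/norm_cvg0P => /=.
set n : R := (\dim {:V})%:R.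
pose b (p : 'End(V) * 'End(V)) :=
  n * `|p.1 - A| * `|p.2| + n * `|A| * `|p.2 - B|.
have bc : b p @[p --> (A, B)] --> (0 : R).
  have -> : 0 = n * 0 * `|B| + n * `|A| * 0 :> R by rewrite !(mulr0, mul0r) addr0.
  have fc : p.1 @[p --> (A, B)] --> A by apply: cvg_fst.
  have sc : p.2 @[p --> (A, B)] --> B by apply: cvg_snd.
  apply: cvgD; apply: cvgM.
  - apply: cvgM; first exact: cvg_cst.
    by apply/norm_cvg0P/subr_cvg0.
  - exact: cvg_norm.
  - exact: cvg_cst.
  - by apply/norm_cvg0P/subr_cvg0.
apply: (squeeze_cvgr _ (cvg_cst 0) bc).
near=> p; rewrite normr_ge0 /=.
have -> : ((p.1 \o p.2) - (A \o B) =
           ((p.1 - A) \o p.2) + (A \o (p.2 - B)))%VF.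
  by rewrite comp_lfunDl comp_lfunDr comp_lfunNl comp_lfunNr addrA subrK.
apply: le_trans (ler_normD _ _) _.
by apply: lerD; exact: comp_lfun_norm_le.
Unshelve. all: by end_near. Qed.

Lemma is_diff_comp_lfun (E : normedModType R) (f df g dg : E -> 'End(V)) x :
  is_diff x f df -> is_diff x g dg ->
  is_diff x (fun y => (f y \o g y)%VF)
    (fun v => (f x \o dg v)%VF + (df v \o g x)%VF).
Proof. exact/is_diff_bilinear/comp_lfun_continuous. Qed.

Lemma Ck_comp (E : normedModType R) k (f g : E -> 'End(V)) :
  Ck k setT f -> Ck k setT g -> Ck k setT (fun x => (f x \o g x)%VF).
Proof. exact/Ck_bilinear/comp_lfun_continuous. Qed.

Lemma continuous_comp_lfun (T : topologicalType) (f g : T -> 'End(V)) (x : T) :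
  {for x, continuous f} -> {for x, continuous g} ->
  {for x, continuous ((fun y => (f y \o g y)%VF) : T -> 'End(V))}.
Proof.
move=> fc gc.
apply: (@continuous_comp _ _ _ (fun x => (f x, g x))
  (fun p : 'End(V) * 'End(V) => (p.1 \o p.2)%VF)).
  exact: cvg_pair fc gc.
exact: comp_lfun_continuous.
Qed.

End FiniteDimension.

(** * Resolvents *)

Section Resolvent.
Context {R : realType} {E : normedModType R} {V : vectType R}.
Variables (X : {linear E -> 'End(V)}) (Rz : E -> 'End(V)).
Hypothesis Xc : continuous X.
Hypothesis Rz_inv_l : forall u, (Rz u \o (\1 - X u) = \1)%VF.
Hypothesis Rz_inv_r : forall u, ((\1 - X u) \o Rz u = \1)%VF.

Lemma resolvent_identity u v : Rz u - Rz v = (Rz u \o X (u - v) \o Rz v)%VF.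
Proof.
transitivity ((Rz u \o ((\1 - X v) \o Rz v)) -
              ((Rz u \o (\1 - X u)) \o Rz v))%VF.
  by rewrite Rz_inv_r Rz_inv_l comp_lfun1l comp_lfun1r.
rewrite comp_lfunA -comp_lfunNl -comp_lfunDl.
congr (_ \o _)%VF; rewrite -comp_lfunNr -comp_lfunDr; congr (_ \o _)%VF.
by rewrite opprB addrC addrA subrK [RHS]linearB.
Qed.

(** By the resolvent identity [R(u + h) = R(u) + R(u + h) X(h) R(u)].  For
    small [h] this bounds [R(u + h)] by twice the norm of [R(u)]; iterated
    once, it shows that the remainder is [R(u + h) X(h) R(u) X(h) R(u)]. *)
Lemma is_diff_resolvent u :
  is_diff u Rz (fun v => (Rz u \o X v \o Rz u)%VF).
Proof.
have lin : linear (fun v => (Rz u \o X v \o Rz u)%VF).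
  move=> c v w; rewrite linearP comp_lfunDr comp_lfunDl.
  by rewrite -comp_lfunZr -comp_lfunZl.
pose LM := GRing.isLinear.Build _ _ _ _ (fun v => (Rz u \o X v \o Rz u)%VF) lin.
pose L : {linear E -> 'End(V)} := HB.pack (fun v => (Rz u \o X v \o Rz u)%VF) LM.
have [k k0 Xk] := linear_lipschitz Xc.
set n : R := (\dim {:V})%:R; set a := `|Rz u|.
have n0 : 0 <= n by rewrite ler0n.
have a0 : 0 <= a by rewrite normr_ge0.
have compl (A B : 'End(V)) (b c : R) : 0 <= b -> `|A| <= b -> `|B| <= c ->
    `|(A \o B)%VF| <= n * b * c.
  move=> b0 Ab Bc; apply: le_trans (comp_lfun_norm_le A B) _.
  by rewrite ler_pM ?mulr_ge0 // ler_wpM2l.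
have bound h : `|h| < (2 * (n * n * k * a + 1))^-1 -> `|Rz (h + u)| <= 2 * a.
  move=> hsmall; have hE := resolvent_identity (h + u) u.
  rewrite addrK in hE; have {}hE := canRL (subrK _) hE.
  have q0 : 0 <= n * n * k * a by rewrite !mulr_ge0 // ltW.
  have qh : n * n * k * a * `|h| <= 2^-1.
    have : (n * n * k * a + 1) * `|h| <= 2^-1.
      rewrite mulrC -ler_pdivlMr ?ltr_wpDl // -invfM ltW //.
    by apply: le_trans; rewrite ler_wpM2r // lerDl.
  have := ler_normD (Rz (h + u) \o X h \o Rz u)%VF (Rz u).
  rewrite -hE -/a.
  have : `|(Rz (h + u) \o X h \o Rz u)%VF| <= n * (n * `|Rz (h + u)| * (k * `|h|)) * a.
    by apply: (compl _ _ _ _) => //; [rewrite !mulr_ge0 // ltW | apply: (compl _ _ _ _)].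
  have -> : n * (n * `|Rz (h + u)| * (k * `|h|)) * a
     = `|Rz (h + u)| * (n * n * k * a * `|h|) by ring.
  have : `|Rz (h + u)| * (n * n * k * a * `|h|) <= `|Rz (h + u)| * 2^-1.
    by rewrite ler_wpM2l.
  set N := `|Rz (h + u)|; set M := `|(_ \o _)%VF|; lra.
apply: (@is_diff_quadratic _ _ _ Rz L u (2 * (n * n * k * a + 1))^-1
  (n * (n * (n * (n * (2 * a) * k) * a) * k) * a)).
- by rewrite invr_gt0 mulr_gt0 // ltr_wpDl // !mulr_ge0 // ltW.
- apply: (@lipschitz_linear_continuous _ _ _ _ (n * (n * a * k) * a)) => v.
  have -> : n * (n * a * k) * a * `|v| = n * (n * a * (k * `|v|)) * a by ring.
  by apply: (compl _ _ _ _) => //; [rewrite !mulr_ge0 // ltW | apply: (compl _ _ _ _)].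
move=> h /bound hb.
have -> : Rz (h + u) - Rz u - L h =
    (Rz (h + u) \o X h \o Rz u \o X h \o Rz u)%VF.
  have hE := resolvent_identity (h + u) u; rewrite addrK in hE.
  by rewrite -hE {1}hE /= -comp_lfunNl -comp_lfunDl -comp_lfunNl -comp_lfunDl.
have -> : n * (n * (n * (n * (2 * a) * k) * a) * k) * a * `|h| ^+ 2
  = n * (n * (n * (n * (2 * a) * (k * `|h|)) * a) * (k * `|h|)) * a by ring.
by do 4![apply: (compl _ _ _ _) => //; first by rewrite ?mulr_ge0 // ltW].
Qed.

(** The differential is a product of resolvents and constants, so each order
    of smoothness follows from the previous one. *)
Lemma Ck_resolvent k : Ck k setT Rz.
Proof.
have dR u v : 'd Rz u v = (Rz u \o X v \o Rz u)%VF.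
  by rewrite (@diff_val _ _ _ _ _ _ _ (is_diff_resolvent u)).
elim: k => [|k IH].
  move=> u _; apply: differentiable_continuous.
  exact: (@ex_diff _ _ _ _ _ _ _ (is_diff_resolvent u)).
split=> [u _|v]; first exact: (@ex_diff _ _ _ _ _ _ _ (is_diff_resolvent u)).
rewrite (_ : (fun u => 'd Rz u v) = fun u => (Rz u \o X v \o Rz u)%VF).
  by apply: Ck_comp => //; apply: Ck_comp => //; exact: Ck_cst.
by apply/funext => u; exact: dR.
Qed.

End Resolvent.

(** * Images of expanding maps *)

Section EmbeddedBall.
Context {R : realType}.

Lemma differentiable_expansion (E F : normedModType R) (f : E -> F) x (e : R) :
  differentiable f x -> 0 < e -> exists2 d, 0 < d &
    forall h, `|h| < d -> `|f (h + x) - f x - 'd f x h| <= e * `|h|.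
Proof.
move=> /diff_locally /eqaddoP fE e0.
have /nbhs_norm0P[d d0 dP] := fE e e0; exists d => // h hd.
by have := dP h hd; rewrite /= !fctE /cst opprD addrA.
Qed.

Lemma is_derive_expansion (F : normedModType R) (c : R -> F) v (e : R) :
  is_derive (0 : R) 1 c v -> 0 < e -> exists2 d, 0 < d &
    forall t, `|t| < d -> `|c t - c 0 - t *: v| <= e * `|t|.
Proof.
move=> [cd cv] e0; have cdiff : differentiable c 0 by exact/derivable1_diffP.
have [d d0 dP] := differentiable_expansion cdiff e0; exists d => // t td.
have := dP t td; rewrite addr0.
by rewrite -[t in 'd c 0 t]mulr1 -[t * 1]/(t *: 1) linearZ /= -deriveE // cv.
Qed.

Lemma is_derive_line (E F : normedModType R) (f : E -> F) (u w : E) (t : R) :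
  differentiable f (u + t *: w) ->
  is_derive t 1 (fun s : R => f (u + s *: w)) ('d f (u + t *: w) w).
Proof.
move=> fd; have dl := is_diff_comp (is_diff_line u w t) (differentiableP fd).
have ld : differentiable (fun s : R => f (u + s *: w)) t by exact: (@ex_diff _ _ _ _ _ _ _ dl).
split; first exact/derivable1_diffP.
rewrite deriveE // (_ : (fun s : R => f (u + s *: w)) = f \o (fun s => u + s *: w)) //.
by rewrite (@diff_val _ _ _ _ _ _ _ dl) /= scale1r.
Qed.

Context {V : vectType R} {d : nat}.
(* f_expand makes the inverse of f on its image Lipschitz, which separates an
   embedding from an injective immersion. *)
Variables (f : 'rV[R]_d -> 'End(V)) (r C : R).
Hypothesis f_smooth : smooth_on setT f.
Hypothesis C0 : 0 <= C.
Hypothesis f_expand : forall u v : 'rV[R]_d, ball 0 r u -> ball 0 r v ->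
  `|u - v| <= C * `|f u - f v|.

Let f_diff u : differentiable f u.
Proof. by have [fd _] := f_smooth 1; exact: fd. Qed.

Let ball_near (u w : 'rV[R]_d) : ball 0 r u ->
  exists2 e, 0 < e & forall t : R, `|t| < e -> ball 0 r (u + t *: w).
Proof.
rewrite -ball_normE /= sub0r normrN => ur.
have w1 : 0 < `|w| + 1 by rewrite ltr_wpDl.
exists ((r - `|u|) / (`|w| + 1)) => [|t]; first by rewrite divr_gt0 // subr_gt0.
rewrite ltr_pdivlMr // => tr; rewrite /= sub0r normrN.
apply: le_lt_trans (ler_normD _ _) _; rewrite -ltrBrDl normrZ.
by apply: le_lt_trans tr; rewrite ler_wpM2l // lerDl.
Qed.

(** A kernel vector [w] of the differential would make [f (u + t w) - f u] small
    with respect to [t]. *)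
Lemma embedded_ball_diff_inj (u : 'rV[R]_d) : ball 0 r u -> injective ('d f u).
Proof.
move=> ur; apply: (raddf_inj (f := 'd f u)) => w fw.
have C1 : 0 < C + 1 by rewrite ltr_wpDl.
have e0 : 0 < (2 * (C + 1))^-1 by rewrite invr_gt0 mulr_gt0.
have [e1 e10 e1P] := differentiable_expansion (f_diff u) e0.
have [e2 e20 e2P] := ball_near w ur.
have w1 : 0 < `|w| + 1 by rewrite ltr_wpDl.
near (0 : R)^'+ => t.
have t0 : 0 < t by [].
have ut : ball 0 r (u + t *: w).
  apply: e2P; rewrite gtr0_norm //; near: t; exact: nbhs_right_lt.
have tw : `|t *: w| < e1.
  rewrite normrZ gtr0_norm //.
  apply: (@le_lt_trans _ _ (t * (`|w| + 1))).
    by rewrite ler_wpM2l ?ltW // ltrDl.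
  rewrite -ltr_pdivlMr //; near: t; apply: nbhs_right_lt; exact: divr_gt0.
have := f_expand ut ur; rewrite (addrC u) addrK => H.
have := e1P _ tw; rewrite linearZ /= fw scaler0 subr0 => H2.
have : `|t *: w| <= C * ((2 * (C + 1))^-1 * `|t *: w|).
  by apply: le_trans H _; rewrite ler_wpM2l.
have CC : C * (2 * (C + 1))^-1 <= 2^-1.
  by rewrite invfM mulrCA ger_pMr // ler_pdivrMr // mul1r lerDl.
rewrite mulrA => H3; have := le_trans H3 (ler_wpM2r (normr_ge0 _) CC).
have := normr_ge0 (t *: w) => ge0 H4.
have : `|t *: w| <= 0 by lra.
by rewrite normr_le0 scaler_eq0 gt_eqF //= => /eqP.
Unshelve. all: by end_near. Qed.

(** Expansion says that the inverse of [f] is Lipschitz on the image of the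
    ball. *)
Lemma embedded_ball_submanifold : submanifold d (f @` ball 0 r).
Proof.
move=> x Nx; exists (ball 0 r), f; split => //.
have f_inj (u v : 'rV[R]_d) : ball 0 r u -> ball 0 r v -> f u = f v -> u = v.
  move=> ur vr fuv; apply/eqP; rewrite -subr_eq0 -normr_le0.
  by have := f_expand ur vr; rewrite fuv subrr normr0 mulr0.
pose h y := get (fun u => ball 0 r u /\ f u = y).
have hP u : ball 0 r u -> h (f u) = u.
  move=> ur; have [hr hf] : ball 0 r (h (f u)) /\ f (h (f u)) = f u.
    by apply: (@getPex _ (fun v => ball 0 r v /\ f v = f u)); exists u.
  exact: f_inj.
split; first exact: ball_open.
- by move=> k; apply: Ck_sub (f_smooth k).
- exact: embedded_ball_diff_inj.
- by exists setT; [exact: openT | rewrite setIT].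
exists h; first exact: hP.
apply/subspace_continuousP => _ [v vr <-]; rewrite /from_subspace hP //.
apply/cvgrPdist_le => e e0; rewrite near_withinE.
have C1 : 0 < `|C| + 1 by rewrite ltr_wpDl.
near=> y => -[w wr yE]; rewrite -yE hP //.
apply: le_trans (f_expand vr wr) _; rewrite yE.
have : `|f v - y| <= e / (`|C| + 1).
  near: y; apply: cvgr_dist_le; [exact: cvg_id | exact: divr_gt0].
rewrite ler_pdivlMr // mulrC; apply: le_trans.
by apply: ler_wpM2r => //; apply: le_trans (ler_norm C) _; rewrite lerDl.
Unshelve. all: by end_near. Qed.

(** A curve in the image lifts to a curve that is Lipschitz at its base point,
    so its velocity is a limit of values of the differential.  These form a
    subspace, which is the kernel of a continuous linear map [p]. *)
Lemma embedded_ball_tangent (u : 'rV[R]_d) : ball 0 r u ->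
  tangent (f @` ball 0 r) (f u) = range ('d f u).
Proof.
move=> ur; apply/seteqP; split=> [v [c [e e0 [_ cN c0 cv]]]|_ [w _ <-]]; last first.
  have [e e0 eP] := ball_near w ur.
  exists (fun t => f (u + t *: w)); exists e => //; split.
  - by move=> k; apply: Ck_sub (Ck_line u w (f_smooth k)).
  - move=> t; rewrite -ball_normE /= sub0r normrN => /eP ut.
    by exists (u + t *: w).
  - by rewrite scale0r addr0.
  - by have := @is_derive_line _ _ f u w 0; rewrite scale0r addr0; apply.
pose D := limg (linfun ('d f u)).
pose p : 'End('End(V)) := (\1 - projv D)%VF.
have pD w : p ('d f u w) = 0.
  rewrite /p add_lfunE opp_lfunE id_lfunE projv_id ?subrr //.
  by rewrite -(lfunE ('d f u)) memv_img ?memvf.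
suff pv : p v = 0.
  have : v \in D.
    move: pv; rewrite /p add_lfunE opp_lfunE id_lfunE => /eqP.
    by rewrite subr_eq0 => /eqP ->; exact: memv_proj.
  by move=> /memv_imgP[w _ ->]; exists w; rewrite ?lfunE.
pose pL : {linear 'End(V) -> 'End(V)} := p.
have [k k0 pk] := linear_lipschitz (@hom_linear_continuous _ _ _ pL).
set M := C * (`|v| + 1).
have M0 : 0 <= M by rewrite mulr_ge0 // addr_ge0.
apply/eqP; rewrite -normr_le0; apply/ler_addgt0Pl => e' e'0; rewrite addr0.
pose e1 := Num.min 1 (e' / (k * (1 + M))).
have kM : 0 < k * (1 + M) by rewrite mulr_gt0 // ltr_pwDl.
have e10 : 0 < e1 by rewrite lt_min ltr01 divr_gt0.
have [d1 d10 d1P] := is_derive_expansion cv e10.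
have [d2 d20 d2P] := differentiable_expansion (f_diff u) e10.
have M1 : 0 < M + 1 by rewrite ltr_wpDl.
near (0 : R)^'+ => t.
have t0 : 0 < t by [].
have td1 : `|t| < d1 by rewrite gtr0_norm //; near: t; exact: nbhs_right_lt.
have td2 : t < d2 / (M + 1) by near: t; apply: nbhs_right_lt; exact: divr_gt0.
have [ut utr utE] : (f @` ball 0 r) (c t).
  apply: cN; rewrite -ball_normE /= sub0r normrN gtr0_norm //.
have ct := d1P t td1; rewrite gtr0_norm // c0 in ct.
have utu : `|ut - u| <= M * t.
  apply: le_trans (f_expand utr ur) _; rewrite utE /M -mulrA ler_wpM2l //.
  rewrite -[c t - f u](subrK (t *: v)); apply: le_trans (ler_normD _ _) _.
  rewrite normrZ gtr0_norm // mulrDl mul1r addrC [t * _]mulrC lerD2l.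
  by apply: le_trans ct _; rewrite ger_pMl // ge_min lexx.
have utd : `|ut - u| < d2.
  apply: le_lt_trans utu _; move: td2; rewrite ltr_pdivlMr // mulrC.
  by apply: le_lt_trans; rewrite ler_wpM2r ?ltW // ltrDl.
have := d2P _ utd; rewrite subrK utE => fut.
have : `|t *: v - 'd f u (ut - u)| <= e1 * (1 + M) * t.
  have -> : t *: v - 'd f u (ut - u) =
     (c t - f u - 'd f u (ut - u)) - (c t - f u - t *: v).
    by rewrite opprB [RHS]addrC addrA subrK.
  apply: le_trans (ler_normB _ _) _; rewrite mulrDr mulr1 mulrDl addrC.
  apply: lerD => //; apply: le_trans fut _.
  by rewrite -mulrA ler_wpM2l // ltW.
move=> /(ler_wpM2l (ltW k0)) /(le_trans (pk _)).
rewrite linearB /= pD subr0 linearZ /= normrZ gtr0_norm // mulrA.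
rewrite [t * _]mulrC ler_pM2r // => /le_trans; apply.
rewrite mulrCA -ler_pdivlMr // ge_min lexx orbT //.
Unshelve. all: by end_near. Qed.

End EmbeddedBall.

(** * Immersions expand near a point *)

Section ImmersionExpands.
Context {R : realType}.

Lemma ball0_convex (E : normedModType R) (r t : R) (u v : E) :
  0 <= t <= 1 -> ball 0 r u -> ball 0 r v -> ball 0 r (v + t *: (u - v)).
Proof.
rewrite -!ball_normE /= !sub0r !normrN => /andP[t0 t1] ur vr.
have -> : v + t *: (u - v) = (1 - t) *: v + t *: u.
  by rewrite scalerBr scalerBl scale1r addrCA addrC.
apply: le_lt_trans (ler_normD _ _) _; rewrite !normrZ !ger0_norm ?subr_ge0 //.
have [->|t_neq0] := eqVneq t 0; first by rewrite subr0 mul1r mul0r addr0.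
have tp : 0 < t by rewrite lt_neqAle eq_sym t_neq0.
apply: (@lt_le_trans _ _ ((1 - t) * r + t * r)).
  by apply: ler_ltD; [rewrite ler_wpM2l ?subr_ge0 // ltW | rewrite ltr_pM2l].
by rewrite -mulrDl subrK mul1r.
Qed.

(** Mean value inequality, applied to each coordinate along a segment. *)
Lemma row_mean_value d (f : 'rV[R]_d -> 'rV[R]_d) (r c : R) :
  (forall u, differentiable f u) ->
  (forall u w : 'rV[R]_d, ball 0 r u -> `|'d f u w| <= c * `|w|) -> 0 <= c ->
  forall u v : 'rV[R]_d, ball 0 r u -> ball 0 r v ->
  `|f u - f v| <= c * `|u - v|.
Proof.
move=> fd dfc c0 u v ur vr; apply: mx_norm_le => [|i j]; first exact: mulr_ge0.
pose w := u - v.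
have clin : linear (fun A : 'rV[R]_d => A i j : R^o).
  by move=> a A B; rewrite !mxE.
pose cM := GRing.isLinear.Build _ _ _ _ (fun A : 'rV[R]_d => A i j : R^o) clin.
pose cL : {linear 'rV[R]_d -> R^o} := HB.pack (fun A : 'rV[R]_d => A i j : R^o) cM.
have cc := @mx_linear_continuous _ _ _ _ cL.
have dphi (t : R) : is_derive t 1 (fun s : R => f (v + s *: w) i j)
    ('d f (v + t *: w) w i j).
  have dc : is_diff (v + t *: w) (cL \o f) (cL \o 'd f (v + t *: w)).
    apply: is_diff_comp; first exact/differentiableP/fd.
    apply: DiffDef; first exact: linear_differentiable.
    by rewrite diff_lin.
  have := @is_derive_line _ _ _ (cL \o f) v w t (@ex_diff _ _ _ _ _ _ _ dc).
  by rewrite (@diff_val _ _ _ _ _ _ _ dc).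
have [t t01 tE] := MVT_segment ler01 (fun t _ => dphi t)
  (derivable_within_continuous (fun t _ => @ex_derive _ _ _ _ _ _ _ (dphi t))).
move: tE; rewrite scale1r scale0r addr0 /w (addrC v) subrK subr0 mulr1 => tE.
rewrite !mxE tE.
apply: le_trans (ler_mx_norm_entry _ _ _) _; apply: dfc.
by apply: ball0_convex => //; rewrite in_itv in t01.
Qed.

Context {V : vectType R} {d : nat}.

(** A linear left inverse of the differential at the origin straightens [f] to
    a map of ['rV_d] to itself whose distance to the identity is a contraction
    near the origin.  This is the half of the inverse function theorem that does
    not use completeness. *)
Lemma immersion_expands (f : 'rV[R]_d -> 'End(V)) :
  smooth_on setT f -> injective ('d f 0) ->
  exists2 r : R, 0 < r & exists2 C : R, 0 <= C &
    forall u v : 'rV[R]_d, ball 0 r u -> ball 0 r v ->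
      `|u - v| <= C * `|f u - f v|.
Proof.
move=> f_smooth df0_inj.
have fd u : differentiable f u by have [fd _] := f_smooth 1; exact: fd.
pose T := linfun ('d f 0).
have T_inj : lker T == 0%VS.
  by apply/lker0P => v w; rewrite !lfunE => /df0_inj.
pose L : {linear 'End(V) -> 'rV[R]_d} := (T^-1)%VF.
have Lc := @hom_linear_continuous _ _ _ L.
have [C C0 LC] := linear_lipschitz Lc.
have LT w : L ('d f 0 w) = w by rewrite -(lfunE ('d f 0)); exact: lker0_lfunK.
pose p u := u - L (f u).
have pd u : is_diff u p (fun w => w - L ('d f u w)).
  have -> : p = id - (L \o f) by [].
  have dLf : is_diff u (L \o f) (L \o 'd f u).
    apply: is_diff_comp; first exact/differentiableP/fd.
    by apply: DiffDef; [exact: linear_differentiable | rewrite diff_lin].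
  exact: is_diffB.
have e0 : 0 < (2 * (d%:R + 1))^-1 :> R by rewrite invr_gt0 mulr_gt0 // ltr_wpDl.
have : \forall u \near (0 : 'rV[R]_d), forall i : 'I_d,
    `|'d p u (delta_mx 0 i)| <= (2 * (d%:R + 1))^-1.
  apply: (@filter_forall _ _
    (fun i u => `|'d p u (delta_mx 0 i)| <= (2 * (d%:R + 1))^-1)
    (nbhs (0 : 'rV[R]_d)) _) => i.
  have dpE u : 'd p u (delta_mx 0 i) = delta_mx 0 i - L ('d f u (delta_mx 0 i)).
    by rewrite (@diff_val _ _ _ _ _ _ _ (pd u)).
  have Lcvg y : L ('d f 0 (delta_mx 0 i)) = y ->
      L ('d f u (delta_mx 0 i)) @[u --> (0 : 'rV[R]_d)] --> y.
    move=> <-.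
    apply: (@continuous_comp _ _ _ (fun u => 'd f u (delta_mx 0 i)) L); last exact: Lc.
    by have [_ dfc] := f_smooth 1; exact: (dfc (delta_mx 0 i) 0).
  have /cvgrPdist_le /(_ _ e0) := Lcvg _ (LT (delta_mx 0 i)).
  by apply: filterS => u; rewrite dpE.
move=> /nbhs_ballP[r r0 dp_small]; exists r => //; exists (2 * C).
  by rewrite mulr_ge0 // ltW.
have dp_half (u w : 'rV[R]_d) : ball 0 r u -> `|'d p u w| <= 2^-1 * `|w|.
  move=> ur; rewrite {1}(row_sum_delta w) linear_sum.
  apply: le_trans (ler_norm_sum _ _ _) _.
  apply: (@le_trans _ _ (\sum_(i < d) `|w| * (2 * (d%:R + 1))^-1)).
    apply: ler_sum => i _; rewrite linearZ normrZ.
    by rewrite ler_pM ?ler_mx_norm_entry // dp_small.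
  rewrite sumr_const card_ord -[leLHS]mulr_natr -mulrA [leLHS]mulrC ler_wpM2r //.
  rewrite invfM -mulrA ger_pMr // mulrC ler_pdivrMr ?ltr_wpDl //.
  by rewrite mul1r lerDl.
move=> u v ur vr.
have := row_mean_value (fun u => @ex_diff _ _ _ _ _ _ _ (pd u)) dp_half
  _ ur vr.
rewrite invr_ge0 ler0n => /(_ isT) puv.
have uvE : u - v = (p u - p v) + L (f u - f v).
  have -> : L (f u - f v) = L (f u) - L (f v) by exact: linearB.
  by rewrite /p opprB [RHS]addrAC !addrA !subrK.
have := ler_normD (p u - p v) (L (f u - f v)); rewrite -uvE.
have := LC (f u - f v); lra.
Qed.

End ImmersionExpands.

(** * Skew endomorphisms and the Cayley transform *)

Section Metric.
Context {R : realType} {V : vectType R} (g : {dot V for idfun}).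

Let gC x y : g x y = g y x. Proof. by rewrite hermC expr0 mul1r. Qed.
Let gN x y : g (- x) y = - g x y. Proof. exact: linearNl. Qed.
Let gNr x y : g y (- x) = - g y x. Proof. exact: linearNr. Qed.
Let gD x y z : g (x + y) z = g x z + g y z. Proof. exact: linearDl. Qed.
Let gDr x y z : g z (x + y) = g z x + g z y. Proof. exact: linearDr. Qed.
Let gZ a x y : g (a *: x) y = a * g x y. Proof. exact: linearZl_LR. Qed.
Let gZr a x y : g y (a *: x) = a * g y x. Proof. by rewrite linearZr_LR. Qed.

Lemma dot_eq0 x : g x x = 0 -> x = 0.
Proof.
move=> gx; apply/eqP; apply: contraT => /(neq0_dnorm_gt0 (s := g)).
by rewrite gx ltxx.
Qed.

(** A relation, so that no adjoint has to be constructed. *)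
Definition adjoint_pair (A B : 'End(V)) := forall x y, g (A x) y = g x (B y).

Lemma adjoint_pair_sym A B : adjoint_pair A B -> adjoint_pair B A.
Proof. by move=> AB x y; rewrite gC -AB gC. Qed.

Lemma adjoint_pair1 : adjoint_pair \1%VF \1%VF.
Proof. by move=> x y; rewrite !id_lfunE. Qed.

Lemma adjoint_pairD A B A' B' : adjoint_pair A B -> adjoint_pair A' B' ->
  adjoint_pair (A + A') (B + B').
Proof. by move=> AB AB' x y; rewrite !add_lfunE gD gDr AB AB'. Qed.

Lemma adjoint_pairZ a A B : adjoint_pair A B -> adjoint_pair (a *: A) (a *: B).
Proof. by move=> AB x y; rewrite !scale_lfunE gZ gZr AB. Qed.

Lemma adjoint_pairN A B : adjoint_pair A B -> adjoint_pair (- A) (- B).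
Proof. by move=> AB x y; rewrite !opp_lfunE gN gNr AB. Qed.

Lemma adjoint_pair_comp A B A' B' : adjoint_pair A B -> adjoint_pair A' B' ->
  adjoint_pair (A \o A')%VF (B' \o B)%VF.
Proof. by move=> AB AB' x y; rewrite !comp_lfunE AB AB'. Qed.

Lemma so_endP A : so_end g A <-> adjoint_pair A (- A).
Proof. by split=> sA x y; rewrite sA ?opp_lfunE gNr ?opprK. Qed.

Lemma twistor_adjoint K : twistor g K -> adjoint_pair K (- K).
Proof.
move=> [K2 gK] x y; have /lfunP/(_ x) := K2.
rewrite comp_lfunE opp_lfunE id_lfunE => Kx.
by rewrite -gK Kx gN opp_lfunE gNr.
Qed.

(** If [x = A x] with [A] skew, then [g x x = g (A x) x = - g x (A x)], which
    is [- g x x]. *)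
Lemma so_end_unit A : so_end g A -> lker (\1 - A)%VF == 0%VS.
Proof.
move=> sA; apply/eqP/vspaceP => x; rewrite memv_ker memv0.
apply/eqP/eqP => [|->]; last by rewrite linear0.
rewrite add_lfunE opp_lfunE id_lfunE => /subr0_eq xA.
apply: dot_eq0; have := sA x x; rewrite -xA; lra.
Qed.

(** If [x = M y] and [M x = 0], then [g x x = g y (e M x) = 0]. *)
Lemma adjoint_ker_img M (e : R) : adjoint_pair M (e *: M) ->
  (limg M :&: lker M = 0)%VS.
Proof.
move=> Madj; apply/vspaceP => x; rewrite memv_cap memv0 memv_ker.
apply/andP/eqP => [[/memv_imgP[y _ xE] /eqP Mx]|->]; last by rewrite mem0v linear0.
by apply: dot_eq0; rewrite {1}xE Madj scale_lfunE Mx scaler0 linear0r.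
Qed.

End Metric.

Section Cayley.
Context {R : realType} {V : vectType R} (g : {dot V for idfun}).
Local Open Scope lfun_scope.
Implicit Types A B Z : 'End(V).

Definition res A : 'End(V) := (\1 - A)^-1.

(** The Cayley transform [(1 + A) (1 - A)^-1], written so that its
    differential is read off that of the resolvent. *)
Definition cayley A : 'End(V) := 2%:R *: res A - \1.

Lemma so_endN A : so_end g A -> so_end g (- A).
Proof. by move=> /so_endP/adjoint_pairN sA; apply/so_endP. Qed.

Lemma res_compl A : so_end g A -> res A \o (\1 - A) = \1.
Proof. by move=> /so_end_unit; exact: lker0_compVf. Qed.

Lemma res_compr A : so_end g A -> (\1 - A) \o res A = \1.
Proof. by move=> /so_end_unit; exact: lker0_compfV. Qed.

Lemma res_comm Z A : so_end g A -> Z \o A = A \o Z -> Z \o res A = res A \o Z.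
Proof.
move=> sA ZA.
have ZA1 : Z \o (\1 - A) = (\1 - A) \o Z.
  by rewrite comp_lfunDr comp_lfunDl comp_lfunNr comp_lfunNl ZA comp_lfun1l comp_lfun1r.
rewrite -[Z in LHS]comp_lfun1l -(res_compl sA) -[res A \o _ \o Z]comp_lfunA -ZA1.
by rewrite -!comp_lfunA res_compr // comp_lfun1r.
Qed.

Lemma res_fixed Z A : so_end g A -> A \o Z = 0 -> res A \o Z = Z.
Proof.
move=> sA AZ; rewrite -[RHS]comp_lfun1l -(res_compl sA) -comp_lfunA.
by rewrite comp_lfunDl comp_lfunNl AZ oppr0 addr0 comp_lfun1l.
Qed.

Lemma adjoint_pair_res A : so_end g A -> adjoint_pair g (res A) (res (- A)).
Proof.
move=> sA x y.
have xE : (\1 - A) (res A x) = x by rewrite -comp_lfunE res_compr // id_lfunE.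
have yE : (\1 - - A) (res (- A) y) = y.
  by rewrite -comp_lfunE res_compr ?id_lfunE //; exact: so_endN.
have /adjoint_pairN/(adjoint_pairD (adjoint_pair1 g)) := (so_endP g A).1 sA.
by move=> adj; rewrite -{1}yE -adj xE.
Qed.

Lemma adjoint_pair_cayley A : so_end g A ->
  adjoint_pair g (cayley A) (cayley (- A)).
Proof.
move=> sA; apply: adjoint_pairD; first exact/adjoint_pairZ/adjoint_pair_res.
exact/adjoint_pairN/adjoint_pair1.
Qed.

Lemma cayleyE A : so_end g A -> cayley A = (\1 + A) \o res A.
Proof.
move=> sA; have -> : \1 + A = 2%:R *: \1 - (\1 - A).
  by rewrite opprB addrCA scaler_nat mulr2n addrK addrC.
by rewrite comp_lfunDl comp_lfunNl res_compr // -comp_lfunZl comp_lfun1l.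
Qed.

Lemma cayley_inv A : so_end g A -> cayley A \o cayley (- A) = \1.
Proof.
move=> sA; have sNA := so_endN sA.
rewrite (cayleyE sA) (cayleyE sNA) -comp_lfunA [res A \o _]comp_lfunA.
by rewrite res_compl // comp_lfun1l -[A in \1 + A]opprK res_compr.
Qed.

Lemma cayley_comm Z A : so_end g A -> Z \o A = A \o Z ->
  Z \o cayley A = cayley A \o Z.
Proof.
move=> sA ZA; rewrite /cayley comp_lfunDr comp_lfunDl comp_lfunNr comp_lfunNl.
by rewrite -comp_lfunZr -comp_lfunZl res_comm // comp_lfun1l comp_lfun1r.
Qed.

Lemma cayley_fixed Z A : so_end g A -> A \o Z = 0 -> cayley A \o Z = Z.
Proof.
move=> sA AZ; rewrite /cayley comp_lfunDl comp_lfunNl -comp_lfunZl res_fixed //.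
by rewrite comp_lfun1l scaler_nat mulr2n addrK.
Qed.

Lemma cayley_res A : so_end g A -> res (- A) \o cayley A = res A.
Proof.
move=> sA; rewrite (cayleyE sA) comp_lfunA -[A in \1 + A]opprK.
by rewrite res_compl ?comp_lfun1l //; exact: so_endN.
Qed.

Lemma cayleyN_res A : so_end g A -> cayley (- A) \o res A = res (- A).
Proof.
move=> sA; have sNA := so_endN sA.
rewrite (cayleyE sNA) -comp_lfunA.
have -> : res (- A) \o res A = res A \o res (- A).
  apply: res_comm => //; apply/esym/res_comm => //.
  by rewrite comp_lfunNl comp_lfunNr.
by rewrite comp_lfunA res_compr // comp_lfun1l.
Qed.

End Cayley.

(** * Orbits under Cayley transforms *)

Section CayleyOrbit.
Context {R : realType} {V : vectType R} (g : {dot V for idfun}) {d : nat}.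
Variables (X : {linear 'rV[R]_d -> 'End(V)}) (K0 : 'End(V)).
Hypothesis soX : forall u, so_end g (X u).
Local Open Scope lfun_scope.

Definition cayley_orbit (u : 'rV[R]_d) : 'End(V) :=
  cayley (X u) \o K0 \o cayley (- X u).

Let Xc : continuous X := @mx_linear_continuous _ _ _ _ X.
Let XN : {linear 'rV[R]_d -> 'End(V)} := \- X.

Let res_is_diff (Y : {linear 'rV[R]_d -> 'End(V)}) u :
    (forall u, so_end g (Y u)) ->
  is_diff u (fun u => cayley (Y u)) (fun w => 2%:R *: (res (Y u) \o Y w \o res (Y u))).
Proof.
move=> soY.
have dR : is_diff u (fun u => res (Y u)) (fun w => res (Y u) \o Y w \o res (Y u)).
  apply: (@is_diff_resolvent _ _ _ Y (fun u => res (Y u))) => [|v|v].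
  - exact: mx_linear_continuous.
  - exact: res_compl.
  - exact: res_compr.
apply: (is_diff_eq (is_diffB (is_diffZ 2%:R dR) (is_diff_cst \1 u))).
by apply/funext => w; rewrite !fctE subr0.
Qed.

(** The two halves of the product rule combine into a bracket because
    [(1 + X)^-1 c(X) = (1 - X)^-1] and [c(-X) (1 - X)^-1 = (1 + X)^-1]. *)
Lemma is_diff_cayley_orbit u :
  is_diff u cayley_orbit (fun w => comm_end
    (2%:R *: (res (X u) \o X w \o res (- X u))) (cayley_orbit u)).
Proof.
have soXN v : so_end g (XN v) by exact/so_endN/soX.
have dc := res_is_diff u soX; have dcN := res_is_diff u soXN.
have dK : is_diff u (fun=> K0) (fun=> 0) := is_diff_cst K0 u.
apply: (is_diff_eq (is_diff_comp_lfun (is_diff_comp_lfun dc dK) dcN)).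
apply/funext => w; rewrite /comm_end /cayley_orbit comp_lfun0r add0r.
have XNE v : XN v = - X v by [].
rewrite !XNE.
rewrite addrC; congr (_ + _).
  rewrite !comp_lfunA; congr (_ \o _ \o _).
  rewrite -!comp_lfunZl; congr (_ *: _); rewrite -!comp_lfunA; congr (_ \o (_ \o _)).
  by rewrite (cayley_res (soX u)).
rewrite comp_lfunNr comp_lfunNl scalerN comp_lfunNr -!comp_lfunZr; congr (- _).
congr (_ *: _); rewrite !comp_lfunA; congr (_ \o _ \o _).
by rewrite -[RHS]comp_lfunA (cayleyN_res (soX u)).
Qed.

Lemma cayley_orbit_smooth : smooth_on setT cayley_orbit.
Proof.
have Cc (Y : {linear 'rV[R]_d -> 'End(V)}) : (forall u, so_end g (Y u)) ->
    forall k, Ck k setT (fun u => cayley (Y u)).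
  move=> soY k; apply: Ck_add; last exact: Ck_cst.
  have -> : (fun u => 2%:R *: res (Y u)) = (fun u => (2%:R *: \1) \o res (Y u)).
    by apply/funext => u; rewrite -comp_lfunZl comp_lfun1l.
  apply: Ck_comp; first exact: Ck_cst.
  apply: (@Ck_resolvent _ _ _ Y (fun u => res (Y u))) => [|v|v].
  - exact: mx_linear_continuous.
  - exact: res_compl.
  - exact: res_compr.
move=> k; apply: Ck_comp.
  by apply: Ck_comp; [exact: Cc | exact: Ck_cst].
by apply: (Cc XN) => u; exact/so_endN/soX.
Qed.

Lemma cayley_orbit0 : cayley_orbit 0 = K0.
Proof.
rewrite /cayley_orbit linear0 oppr0.
have so0 : so_end g (0 : 'End(V)) by have := soX 0; rewrite linear0.
have c0 : cayley (0 : 'End(V)) = \1.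
  by rewrite -[LHS]comp_lfun1r (cayley_fixed so0) // comp_lfun0l.
by rewrite c0 comp_lfun1l comp_lfun1r.
Qed.

Lemma cayley_orbit_twistor u : twistor g K0 -> twistor g (cayley_orbit u).
Proof.
move=> [K2 gK]; have sX := soX u; have sNX := so_endN sX.
have cNc : cayley (- X u) \o cayley (X u) = \1.
  by have := cayley_inv sNX; rewrite opprK.
split.
  rewrite /cayley_orbit -!comp_lfunA [cayley (- X u) \o _]comp_lfunA cNc comp_lfun1l.
  rewrite [K0 \o (K0 \o _)]comp_lfunA K2 comp_lfunNl comp_lfun1l comp_lfunNr.
  by rewrite (cayley_inv sX).
move=> x y; rewrite /cayley_orbit !comp_lfunE (adjoint_pair_cayley sX).
rewrite -[cayley (- X u) (cayley (X u) _)]comp_lfunE cNc id_lfunE gK.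
rewrite (adjoint_pair_cayley sNX) opprK -[cayley (X u) (cayley (- X u) _)]comp_lfunE.
by rewrite (cayley_inv sX) id_lfunE.
Qed.

Lemma cayley_orbit_comm u Z : Z \o X u = X u \o Z -> Z \o K0 = K0 \o Z ->
  Z \o cayley_orbit u = cayley_orbit u \o Z.
Proof.
move=> ZX ZK; have sX := soX u; have sNX := so_endN sX.
have ZNX : Z \o (- X u) = (- X u) \o Z by rewrite comp_lfunNl comp_lfunNr ZX.
rewrite /cayley_orbit !comp_lfunA (cayley_comm sX ZX) -[_ \o Z \o K0]comp_lfunA ZK.
by rewrite -!comp_lfunA (cayley_comm sNX ZNX).
Qed.

(** Used with [Z] the projection complementary to the support of [X u], where
    the orbit does not move [K0]. *)
Lemma cayley_orbit_fixed u Z : X u \o Z = 0 -> Z \o K0 = K0 \o Z ->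
  cayley_orbit u \o Z = K0 \o Z.
Proof.
move=> XZ ZK; have sX := soX u; have sNX := so_endN sX.
have NXZ : (- X u) \o Z = 0 by rewrite comp_lfunNl XZ oppr0.
rewrite /cayley_orbit -!comp_lfunA (cayley_fixed sNX NXZ) -ZK.
by rewrite comp_lfunA (cayley_fixed sX XZ).
Qed.

(** Conjugation turns brackets with [K0] into brackets with another point of
    the orbit; this compares the dimensions of the distribution at the two
    points. *)
Lemma comm_cayley_orbit u B : comm_end B (cayley_orbit u) =
  cayley (X u) \o comm_end (cayley (- X u) \o B \o cayley (X u)) K0
    \o cayley (- X u).
Proof.
have sX := soX u; have sNX := so_endN sX.
rewrite /comm_end /cayley_orbit comp_lfunDr comp_lfunDl comp_lfunNr comp_lfunNl.
rewrite !comp_lfunA (cayley_inv sX) comp_lfun1l; congr (_ - _).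
by rewrite -[RHS]comp_lfunA (cayley_inv sX) comp_lfun1r.
Qed.

End CayleyOrbit.

(** * Supports *)

Section Support.
Context {R : realType} {V : vectType R}.
Local Open Scope lfun_scope.
Implicit Types P M B Z T : 'End(V).

(** Depends on [M] only through its image and its kernel, so that the same [P]
    can serve at all points of a leaf. *)
Definition projection_along P M := [/\ forall x, P x \in limg M,
  forall x, x \in limg M -> P x = x & forall x, (P x == 0) = (M x == 0)].

Lemma projection_along_exists M : (limg M :&: lker M = 0)%VS ->
  exists P, projection_along P M.
Proof.
move=> cap0; have VE : (limg M + lker M = {:V})%VS.
  apply/eqP; rewrite eqEdim subvf dimv_disjoint_sum //.
  by rewrite -(limg_ker_dim M {:V}) capfv addnC leqnn.
exists (daddv_pi (limg M) (lker M)); split=> [x|x|x]; first exact: memv_pi.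
  exact: daddv_pi_id.
have xE : daddv_pi (limg M) (lker M) x + daddv_pi (lker M) (limg M) x = x.
  by apply: daddv_pi_add => //; rewrite VE memvf.
have Mk : M (daddv_pi (lker M) (limg M) x) = 0.
  by apply/eqP; rewrite -memv_ker memv_pi.
apply/eqP/eqP => [P0|Mx]; first by rewrite -xE P0 add0r.
have : daddv_pi (limg M) (lker M) x \in (limg M :&: lker M)%VS.
  rewrite memv_cap memv_pi memv_ker /=.
  by rewrite (canRL (addrK _) xE) linearB /= Mk Mx subrr eqxx.
by rewrite cap0 memv0 => /eqP.
Qed.

Section Along.
Variables P M : 'End(V).
Hypothesis PM : projection_along P M.

Lemma projection_idem : P \o P = P.
Proof. by have [Pi Pid _] := PM; apply/lfunP => x; rewrite comp_lfunE Pid. Qed.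

Lemma projection_compl : P \o M = M.
Proof.
have [_ Pid _] := PM; apply/lfunP => x; rewrite comp_lfunE Pid //.
by rewrite memv_img ?memvf.
Qed.

Lemma projection_compl0 : M \o (\1 - P) = 0.
Proof.
have [_ _ Pk] := PM; apply/lfunP => x; rewrite comp_lfunE zero_lfunE.
apply/eqP; rewrite -Pk -comp_lfunE comp_lfunDr comp_lfunNr projection_idem.
by rewrite comp_lfun1r subrr zero_lfunE.
Qed.

Lemma projection_unit : lker (M + (\1 - P)) == 0%VS.
Proof.
have [_ Pid Pk] := PM; apply/eqP/vspaceP => x; rewrite memv_ker memv0.
apply/eqP/eqP => [Hx|->]; last by rewrite linear0.
have : P ((M + (\1 - P)) x) = 0 by rewrite Hx linear0.
rewrite -comp_lfunE comp_lfunDr projection_compl comp_lfunDr comp_lfun1r.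
rewrite comp_lfunNr projection_idem subrr addr0 => /eqP Mx.
move: Hx; rewrite add_lfunE (eqP Mx) add0r add_lfunE opp_lfunE id_lfunE.
by move: Mx; rewrite -Pk => /eqP ->; rewrite subr0.
Qed.

(** The hypotheses make the image and the kernel of [M] stable under [Z]. *)
Lemma projection_comm Z T T' : Z \o M = M \o T -> M \o Z = T' \o M ->
  P \o Z = Z \o P.
Proof.
have [Pi Pid Pk] := PM; move=> ZM MZ; apply/lfunP => x; rewrite !comp_lfunE.
have -> : P (Z x) = P (Z (P x)).
  apply/eqP; rewrite -subr_eq0 -!linearB Pk -comp_lfunE MZ comp_lfunE.
  have /eqP -> : M (x - P x) == 0.
    by rewrite -Pk linearB /= (Pid (P x)) // subrr.
  by rewrite linear0.
rewrite Pid //; have /memv_imgP[y _ ->] := Pi x.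
by rewrite -comp_lfunE ZM comp_lfunE memv_img ?memvf.
Qed.

Lemma supported_onP B : supported_on M B <-> B \o P = B /\ P \o B = B.
Proof.
have [Pi Pid Pk] := PM; split=> [[Bk Bi]|[BP PB]].
  have BP : B \o P = B.
    apply/lfunP => x; rewrite comp_lfunE; apply/eqP; rewrite -subr_eq0 -linearB.
    rewrite -memv0 -Bk memv_img // memv_ker -Pk linearB /= (Pid (P x)) //.
    by rewrite subrr.
  split=> //; apply/lfunP => x; rewrite comp_lfunE Pid //.
  by rewrite -BP comp_lfunE (subvP Bi) // memv_img.
split.
  apply/eqP; rewrite -subv0; apply/subvP => _ /memv_imgP[x xk ->].
  rewrite memv0 -BP comp_lfunE; move: xk; rewrite memv_ker -Pk => /eqP ->.
  by rewrite linear0.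
by apply/subvP => _ /memv_imgP[x _ ->]; rewrite -PB comp_lfunE.
Qed.

(** A converse of [projection_compl], [projection_compl0] and
    [projection_unit]; its last hypothesis is an open condition. *)
Lemma projection_along_stable M' : M' \o P = M' -> P \o M' = M' ->
  lker (M' + (\1 - P)) == 0%VS -> projection_along P M'.
Proof.
move=> M'P PM' H0; have Pi := projection_idem; split=> [x|x /memv_imgP[y _ ->]|x].
- have /memv_imgP[y _ PxE] : P x \in limg (M' + (\1 - P)).
    by rewrite lker0_limgf ?memvf.
  have -> : P x = M' y; last by rewrite memv_img ?memvf.
  rewrite -Pi comp_lfunE PxE -comp_lfunE !comp_lfunDr PM' comp_lfun1r.
  by rewrite comp_lfunNr Pi subrr addr0.
- by rewrite -comp_lfunE PM'.
apply/eqP/eqP => [Px|M'x]; first by rewrite -M'P comp_lfunE Px linear0.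
have /lker0P H_inj := H0; apply: H_inj; rewrite linear0 !add_lfunE opp_lfunE id_lfunE.
by rewrite -!comp_lfunE M'P Pi M'x add0r subrr.
Qed.

(** Passing from [M] to a factor enlarges the image and shrinks the kernel. *)
Lemma supported_on_factor T T' B : M = T' \o T -> M = T \o T' ->
  B \o P = B -> P \o B = B -> supported_on T B.
Proof.
have [Pi Pid Pk] := PM; move=> M1 M2 BP PB; split.
  apply/eqP; rewrite -subv0; apply/subvP => _ /memv_imgP[x xk ->].
  rewrite memv0 -BP comp_lfunE.
  have /eqP -> : P x == 0.
    rewrite Pk M1 comp_lfunE; move: xk; rewrite memv_ker => /eqP ->.
    by rewrite linear0.
  by rewrite linear0.
apply/subvP => _ /memv_imgP[x _ ->]; rewrite -PB comp_lfunE.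
by have /memv_imgP[y _ ->] := Pi (B x); rewrite M2 comp_lfunE memv_img ?memvf.
Qed.

End Along.

(** Take a subspace of maximal dimension inside [D]. *)
Lemma vspace_of_closed (W : vectType R) (D : set W) : D 0 ->
  (forall c x y, D x -> D y -> D (c *: x + y)) ->
  exists U : {vspace W}, forall x, x \in U <-> D x.
Proof.
move=> D0 Dlin.
pose p m := `[< exists2 U : {vspace W}, forall x, x \in U -> D x & \dim U = m >].
have p0 : exists m, p m.
  exists 0%N; apply/asboolP; exists 0%VS; last exact: dimv0.
  by move=> x; rewrite memv0 => /eqP ->.
have pmax m : p m -> (m <= \dim {:W})%N.
  by move=> /asboolP[U _ <-]; exact/dimvS/subvf.
case: (ex_maxnP p0 pmax) => m /asboolP[U UD Um] mmax.
exists U => x; split=> [/UD //|Dx].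
have UxD y : y \in (U + <[x]>)%VS -> D y.
  by move=> /memv_addP[u uU [_ /vlineP[c ->] ->]]; rewrite addrC; apply/Dlin/UD.
have : (U + <[x]> <= U)%VS.
  have /eqP <- : U == (U + <[x]>)%VS => //.
  by rewrite eqEdim addvSl Um; apply/mmax/asboolP; exists (U + <[x]>)%VS.
by move=> /subvP; apply; rewrite memvE addvSr.
Qed.

End Support.

Section OpenUnits.
Context {R : realType} {V : vectType R}.

(** Let [H u] kill [x] and let [Z] be a projection onto the line of [x].  Then
    [Z = (H 0)^-1 (H 0 - H u) Z], which forces [Z = 0] once [H u] is close to
    [H 0]. *)
Lemma near_unit (E : normedModType R) (H : E -> 'End(V)) :
  {for 0, continuous H} -> lker (H 0) == 0%VS ->
  exists2 r : R, 0 < r & forall u, ball 0 r u -> lker (H u) == 0%VS.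
Proof.
move=> Hc H0; set n : R := (\dim {:V})%:R.
have n0 : 0 <= n by rewrite ler0n.
set c := `|(H 0)^-1%VF|; have c0 : 0 <= c by exact: normr_ge0.
have nc : 0 <= n * n * c by rewrite !mulr_ge0.
have e0 : 0 < (2 * (n * n * c + 1))^-1 by rewrite invr_gt0 mulr_gt0 // ltr_wpDl.
have /cvgrPdist_le/(_ _ e0)/nbhs_ballP[r r0 Hr] := Hc.
exists r => // u /Hr H0u; apply/eqP/vspaceP => x; rewrite memv_ker memv0.
apply/eqP/eqP => [Hx|->]; last by rewrite linear0.
pose Z := projv <[x]>%VS.
have HZ : (H u \o Z)%VF = 0.
  apply/lfunP => y; rewrite comp_lfunE zero_lfunE.
  have /vlineP[b ->] : Z y \in <[x]>%VS by exact: memv_proj.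
  by rewrite linearZ /= Hx scaler0.
have ZE : Z = ((H 0)^-1 \o ((H 0 - H u) \o Z))%VF.
  rewrite comp_lfunDl comp_lfunNl HZ subr0 comp_lfunA lker0_compVf //.
  by rewrite comp_lfun1l.
have : `|Z| <= n * c * (n * (2 * (n * n * c + 1))^-1 * `|Z|).
  rewrite {1}ZE; apply: le_trans (comp_lfun_norm_le _ _) _.
  rewrite -/n -/c ler_wpM2l ?mulr_ge0 //.
  apply: le_trans (comp_lfun_norm_le _ _) _.
  by rewrite -/n ler_wpM2r // ler_wpM2l.
have -> : n * c * (n * (2 * (n * n * c + 1))^-1 * `|Z|)
    = (n * n * c) * (2 * (n * n * c + 1))^-1 * `|Z| by ring.
have half : (n * n * c) * (2 * (n * n * c + 1))^-1 <= 2^-1.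
  by rewrite invfM mulrCA ger_pMr // ler_pdivrMr ?ltr_wpDl // mul1r lerDl.
move=> Zle; have := le_trans Zle (ler_wpM2r (normr_ge0 Z) half).
have := normr_ge0 Z => Zge Zle2; have : `|Z| <= 0 by lra.
rewrite normr_le0 => /eqP Z0.
by rewrite -(projv_id (memv_line x)) -/Z Z0 zero_lfunE.
Qed.

End OpenUnits.

(** * Polynomials in an endomorphism *)

Section Polynomials.
Context {R : realType} {V : vectType R}.
Local Open Scope lfun_scope.
Implicit Types A Z : 'End(V).

Definition poly_end k (c : 'I_k.+1 -> R) A : 'End(V) :=
  \sum_(i < k.+1) c i *: exp_end A i.

Lemma exp_end_comm A Z i : Z \o A = A \o Z -> Z \o exp_end A i = exp_end A i \o Z.
Proof.
move=> ZA; rewrite /exp_end; elim: i => [|i IH] /=.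
  by rewrite comp_lfun1l comp_lfun1r.
by rewrite comp_lfunA ZA -!comp_lfunA IH.
Qed.

Lemma poly_end_comm k c A Z : Z \o A = A \o Z ->
  Z \o @poly_end k c A = poly_end c A \o Z.
Proof.
move=> ZA; rewrite /poly_end.
rewrite (linear_sumr (@comp_lfun R V V V)) (linear_sumlz (@comp_lfun R V V V)).
by apply: eq_bigr => i _ /=; rewrite -comp_lfunZl -comp_lfunZr exp_end_comm.
Qed.

Lemma poly_end_fixed k c A A0 Z : A \o Z = A0 \o Z -> Z \o A0 = A0 \o Z ->
  @poly_end k c A \o Z = poly_end c A0 \o Z.
Proof.
move=> AZ ZA0; rewrite /poly_end.
rewrite !(linear_sumlz (@comp_lfun R V V V)); apply: eq_bigr => i _ /=.
rewrite -!comp_lfunZl; congr (_ *: _).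
elim: {i}(nat_of_ord i) => [|i IH] //.
rewrite -[exp_end A i.+1]/(A \o exp_end A i) -[exp_end A0 i.+1]/(A0 \o exp_end A0 i).
by rewrite -!comp_lfunA IH -exp_end_comm // !comp_lfunA AZ.
Qed.

Lemma adjoint_pair_poly_end (g : {dot V for idfun}) k c A : adjoint_pair g A A ->
  adjoint_pair g (@poly_end k c A) (poly_end c A).
Proof.
move=> Aadj; rewrite /poly_end.
apply: (big_ind (fun B => adjoint_pair g B B)) => [x y|B B'|i _].
- by rewrite !zero_lfunE linear0l linear0r.
- exact: adjoint_pairD.
apply: adjoint_pairZ; elim: {i}(nat_of_ord i) => [|i IH]; first exact: adjoint_pair1.
rewrite -[exp_end A i.+1]/(A \o exp_end A i) {2}(exp_end_comm i (erefl (A \o A))).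
exact: adjoint_pair_comp.
Qed.

Lemma poly_end_continuous k c (T : topologicalType) (A : T -> 'End(V)) x :
  {for x, continuous A} -> {for x, continuous (fun y => @poly_end k c (A y))}.
Proof.
move=> Ac; have -> : (fun y => poly_end c (A y)) =
    \sum_(i < k.+1) (fun y => c i *: exp_end (A y) i).
  by apply/funext => y; rewrite fct_sumE.
apply: (big_ind (fun h : T -> 'End(V) => {for x, continuous h})) => [|h h'|i _].
- exact: cst_continuous.
- exact: continuousD.
apply: continuousZl_tmp; elim: {i}(nat_of_ord i) => [|i IH].
  exact: cst_continuous.
exact: continuous_comp_lfun.
Qed.

End Polynomials.

(** * The sections 1, J + K, J - K and [J, K] *)

Section BasicSections.
Context {R : realType} {V : vectType R} (g : {dot V for idfun}).
Local Open Scope lfun_scope.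
Implicit Types J K Z : 'End(V).

Definition basic_section J (s : 'End(V) -> 'End(V)) :=
  [\/ s = (fun=> \1), s = (fun K => J + K), s = (fun K => J - K)
    | s = comm_end J].

Lemma anticomm_comm J K Z : Z \o J = J \o Z -> Z \o K = K \o Z ->
  Z \o anticomm_end J K = anticomm_end J K \o Z.
Proof.
move=> ZJ ZK; rewrite /anticomm_end comp_lfunDr comp_lfunDl !comp_lfunA ZJ ZK.
by rewrite -!comp_lfunA ZJ ZK.
Qed.

Lemma anticomm_fixed J K K0 Z : Z \o J = J \o Z -> Z \o K0 = K0 \o Z ->
  K \o Z = K0 \o Z -> anticomm_end J K \o Z = anticomm_end J K0 \o Z.
Proof.
move=> ZJ ZK KZ; rewrite /anticomm_end !comp_lfunDl -!comp_lfunA KZ -ZJ.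
by rewrite [K \o _]comp_lfunA [K0 \o (Z \o _)]comp_lfunA KZ.
Qed.

Lemma anticomm_commJ J K : K \o K = - \1 -> J \o J = - \1 ->
  J \o anticomm_end J K = anticomm_end J K \o J /\
  K \o anticomm_end J K = anticomm_end J K \o K.
Proof.
move=> K2 J2; rewrite /anticomm_end !comp_lfunDl !comp_lfunDr !comp_lfunA J2 K2.
rewrite -!comp_lfunA J2 K2 !(comp_lfunNl, comp_lfunNr, comp_lfun1l, comp_lfun1r).
by split; rewrite addrC.
Qed.

Section Facts.
Variables (J : 'End(V)) (s : 'End(V) -> 'End(V)).
Hypothesis sJ : basic_section J s.

Lemma basic_section_comm K Z : Z \o J = J \o Z -> Z \o K = K \o Z ->
  Z \o s K = s K \o Z.
Proof.
move=> ZJ ZK; case: sJ => ->.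
- by rewrite comp_lfun1l comp_lfun1r.
- by rewrite comp_lfunDr comp_lfunDl ZJ ZK.
- by rewrite comp_lfunDr comp_lfunDl comp_lfunNr comp_lfunNl ZJ ZK.
rewrite /comm_end comp_lfunDr comp_lfunDl comp_lfunNr comp_lfunNl !comp_lfunA ZJ ZK.
by rewrite -!comp_lfunA ZJ ZK.
Qed.

Lemma basic_section_fixed K K0 Z : Z \o J = J \o Z -> Z \o K0 = K0 \o Z ->
  K \o Z = K0 \o Z -> s K \o Z = s K0 \o Z.
Proof.
move=> ZJ ZK KZ; case: sJ => -> //.
- by rewrite !comp_lfunDl KZ.
- by rewrite !comp_lfunDl !comp_lfunNl KZ.
rewrite /comm_end !comp_lfunDl !comp_lfunNl -!comp_lfunA KZ -ZJ.
by rewrite !comp_lfunA KZ.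
Qed.

(** Moving [J] across [s K] turns it into [J], [K], [-K] or [-J] in the four
    cases, and symmetrically for [K]; hence the image and the kernel of [s K] are
    stable under both. *)
Lemma basic_section_intertwine K Z : J \o J = - \1 -> K \o K = - \1 ->
  Z = J \/ Z = K ->
  exists T T', [/\ Z \o s K = s K \o T, s K \o Z = T' \o s K &
    T' \o anticomm_end J K = anticomm_end J K \o T'].
Proof.
move=> J2 K2 ZJK; have [AJ AK] := anticomm_commJ K2 J2.
have AN T : T \o anticomm_end J K = anticomm_end J K \o T ->
    (- T) \o anticomm_end J K = anticomm_end J K \o (- T).
  by rewrite comp_lfunNl comp_lfunNr => ->.
pose simplE := (comp_lfunDl, comp_lfunDr, comp_lfunNl, comp_lfunNr,
  comp_lfun1l, comp_lfun1r, J2, K2, opprD, opprK).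
have assocJ T : T \o J \o J = - T by rewrite -comp_lfunA J2 !simplE.
have assocK T : T \o K \o K = - T by rewrite -comp_lfunA K2 !simplE.
case: sJ => ->.
- exists Z, Z; rewrite comp_lfun1l comp_lfun1r; split=> //.
  by case: ZJK => ->.
- by case: ZJK => ->; [exists K, K | exists J, J]; split=> //;
    rewrite !simplE addrC.
- by case: ZJK => ->; [exists (- K), (- K) | exists (- J), (- J)];
    (split; last exact: AN); rewrite !simplE 1?addrC.
exists (- Z), (- Z); case: ZJK => ->; (split; last exact: AN).
- by rewrite /comm_end !simplE !comp_lfunA ?assocJ ?assocK !simplE addrC.
- by rewrite /comm_end !simplE !comp_lfunA ?assocJ ?assocK !simplE addrC.
- by rewrite /comm_end !simplE !comp_lfunA ?assocJ ?assocK !simplE addrC.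
by rewrite /comm_end !simplE !comp_lfunA ?assocJ ?assocK !simplE addrC.
Qed.

Lemma basic_section_adjoint K : twistor g J -> twistor g K ->
  exists e : R, adjoint_pair g (s K) (e *: s K).
Proof.
move=> /twistor_adjoint aJ /twistor_adjoint aK; case: sJ => ->.
- by exists 1; rewrite scale1r; exact: adjoint_pair1.
- by exists (-1); rewrite scaleN1r opprD; exact: adjoint_pairD.
- exists (-1); rewrite scaleN1r opprD; apply: adjoint_pairD => //.
  exact: adjoint_pairN.
exists (-1); rewrite scaleN1r /comm_end opprD opprK [X in adjoint_pair _ _ X]addrC.
apply: adjoint_pairD.
  have := adjoint_pair_comp aJ aK.
  by rewrite comp_lfunNl comp_lfunNr opprK.
apply: adjoint_pairN; have := adjoint_pair_comp aK aJ.
by rewrite comp_lfunNl comp_lfunNr opprK.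
Qed.

Lemma basic_section_continuous (T : topologicalType) (f : T -> 'End(V)) x :
  {for x, continuous f} -> {for x, continuous (fun y => s (f y))}.
Proof.
move=> fc; case: sJ => ->.
- exact: cst_continuous.
- by apply: (@continuousD _ _ _ (fun=> J) f) => //; exact: cst_continuous.
- by apply: (@continuousB _ _ _ (fun=> J) f) => //; exact: cst_continuous.
apply: (@continuousB _ _ _ (fun y => J \o f y) (fun y => f y \o J)).
  by apply: continuous_comp_lfun => //; exact: cst_continuous.
by apply: continuous_comp_lfun => //; exact: cst_continuous.
Qed.

Lemma anticomm_continuous (T : topologicalType) (f : T -> 'End(V)) x :
  {for x, continuous f} -> {for x, continuous (fun y => anticomm_end J (f y))}.
Proof.
move=> fc.
apply: (@continuousD _ _ _ (fun y => J \o f y) (fun y => f y \o J)).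
  by apply: continuous_comp_lfun => //; exact: cst_continuous.
by apply: continuous_comp_lfun => //; exact: cst_continuous.
Qed.

End Facts.

Lemma adjoint_pair_anticomm J K : twistor g J -> twistor g K ->
  adjoint_pair g (anticomm_end J K) (anticomm_end J K).
Proof.
move=> /twistor_adjoint aJ /twistor_adjoint aK; rewrite /anticomm_end.
rewrite [X in adjoint_pair _ _ X]addrC; apply: adjoint_pairD.
  have := adjoint_pair_comp aJ aK; by rewrite comp_lfunNl comp_lfunNr opprK.
have := adjoint_pair_comp aK aJ; by rewrite comp_lfunNl comp_lfunNr opprK.
Qed.

End BasicSections.

(** * Functions constant along a distribution *)

Section DirectionalDerivative.
Context {R : realType} {E : normedModType R}.

(** [dir_deriv] only speaks of some curve with velocity [v]; a local smooth
    extension of [a] shows that any other curve gives the same derivative. *)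
Lemma dir_deriv_diff (N U : set E) (a F : E -> R) x v l :
  open U -> U x -> differentiable F x -> (forall y, N y -> U y -> F y = a y) ->
  dir_deriv N a x v l -> 'd F x v = l.
Proof.
move=> Uo Ux Fd FE [c [e e0 [csm cN c0 cv]] [_ ac]].
have cd : differentiable c 0 by apply/derivable1_diffP; case: cv.
have dFc : is_diff 0 (F \o c) ('d F x \o 'd c 0).
  by apply: is_diff_comp; [exact: differentiableP | rewrite c0; exact: differentiableP].
have cU : \forall t \near (0 : R), U (c t).
  by apply: (differentiable_continuous cd); rewrite c0; exact: open_nbhs_nbhs.
have near_a : \forall t \near (0 : R), (F \o c) t = (a \o c) t.
  near=> t; apply: FE; last by near: t.
  by apply: cN; near: t; exact: nbhsx_ballx.
rewrite -ac -(near_eq_derive _ near_a) deriveE; last exact: (@ex_diff _ _ _ _ _ _ _ dFc).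
rewrite (@diff_val _ _ _ _ _ _ _ dFc) /= -(deriveE (1 : R) cd).
by case: cv => _ ->.
Unshelve. all: by end_near. Qed.

(** Mean value theorem along the radius from the origin to [u]. *)
Lemma dir_deriv0_cst (E' : normedModType R) (N : set E) (a : E -> R)
    (f : E' -> E) (r : R) (u : E') :
  smooth_fun N a -> (forall v, differentiable f v) ->
  (forall v, ball 0 r v -> N (f v)) ->
  (forall v w, ball 0 r v -> dir_deriv N a (f v) ('d f v w) 0) ->
  ball 0 r u -> a (f u) = a (f 0).
Proof.
move=> asm fd fN da0 ur.
have r0 : 0 < r by move: ur; rewrite -ball_normE /=; exact: le_lt_trans (normr_ge0 _).
have tu_ball (t : R) : t \in `[0, 1] -> ball 0 r (0 + t *: u).
  move=> t01; rewrite -[u]subr0; apply: ball0_convex => //; exact: ballxx.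
have da (t : R) : t \in `[0, 1] ->
    is_derive t 1 (fun s : R => a (f (0 + s *: u))) 0.
  move=> /tu_ball tur; have [U [F [Uo Ux Fsm FE]]] := asm _ (fN _ tur).
  have Fd : differentiable F (f (0 + t *: u)) by have [Fd _] := Fsm 1; exact: Fd.
  have dFf : is_diff (0 + t *: u) (F \o f)
      ('d F (f (0 + t *: u)) \o 'd f (0 + t *: u)).
    by apply: is_diff_comp; exact: differentiableP.
  have := @is_derive_line _ _ _ (F \o f) 0 u t (@ex_diff _ _ _ _ _ _ _ dFf).
  rewrite (@diff_val _ _ _ _ _ _ _ dFf) /= (dir_deriv_diff Uo Ux Fd FE (da0 _ u tur)).
  apply: near_eq_is_derive.
  have lc : {for t, continuous (fun s : R => 0 + s *: u)}.
    apply: differentiable_continuous.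
    exact: (@ex_diff _ _ _ _ _ _ _ (is_diff_line _ _ _)).
  have fc : {for t, continuous (fun s : R => f (0 + s *: u))}.
    apply: (@continuous_comp _ _ _ (fun s : R => 0 + s *: u) f) => //.
    exact/differentiable_continuous/fd.
  near=> s; apply: FE; last by near: s; apply: fc; exact: open_nbhs_nbhs.
  by apply: fN; near: s; apply: lc; apply: open_nbhs_nbhs; split=> //; exact: ball_open.
have [t _] := MVT_segment ler01
  (fun t t01 => da t (subset_itv_oo_cc t01))
  (derivable_within_continuous
    (fun t t01 => @ex_derive _ _ _ _ _ _ _ (da t t01))).
by rewrite mul0r add0r scale1r add0r scale0r => /subr0_eq.
Unshelve. all: by end_near. Qed.

End DirectionalDerivative.

(** * Linear maps used to count dimensions *)

Section LinearMaps.
Context {R : realType} {V : vectType R}.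

(** Named, as [sandwich] below, in order to carry a linear structure. *)
Definition bracket (K B : 'End(V)) : 'End(V) := comm_end B K.

Lemma bracket_linear K : linear (bracket K).
Proof.
move=> c A B; rewrite /bracket /comm_end comp_lfunDl comp_lfunDr.
by rewrite -comp_lfunZl -comp_lfunZr opprD addrACA scalerBr.
Qed.

HB.instance Definition _ K := GRing.isLinear.Build _ _ _ _ (bracket K)
  (bracket_linear K).

Definition sandwich (A C B : 'End(V)) : 'End(V) := (A \o B \o C)%VF.

Lemma sandwich_linear A C : linear (sandwich A C).
Proof.
move=> c B B'; rewrite /sandwich comp_lfunDr comp_lfunDl.
by rewrite -comp_lfunZr -comp_lfunZl.
Qed.

HB.instance Definition _ A C := GRing.isLinear.Build _ _ _ _ (sandwich A C)
  (sandwich_linear A C).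

Context {W : vectType R}.

Definition basis_comb (U : {vspace W}) (w : 'rV[R]_(\dim U)) : W :=
  \sum_i w 0 i *: (vbasis U)`_i.

Lemma basis_comb_linear U : linear (@basis_comb U).
Proof.
move=> c v w; rewrite /basis_comb scaler_sumr -big_split /=.
by apply: eq_bigr => i _; rewrite !mxE scalerDl scalerA.
Qed.

HB.instance Definition _ U := GRing.isLinear.Build _ _ _ _ (@basis_comb U)
  (basis_comb_linear (U := U)).

Lemma basis_comb_mem U w : @basis_comb U w \in U.
Proof.
apply: memv_suml => i _; apply: memvZ; apply: vbasis_mem.
by rewrite mem_nth // size_tuple.
Qed.

Lemma basis_comb_eq0 U w : @basis_comb U w = 0 -> w = 0.
Proof.
move=> w0; apply/rowP => i; rewrite mxE.
have <- : coord (vbasis U) i (basis_comb w) = w 0 i.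
  by rewrite coord_sum_free // (basis_free (vbasisP U)).
by rewrite w0 linear0.
Qed.

End LinearMaps.

(** * Integral submanifolds *)

Section Distributions.
Context {R : realType} {V : vectType R} (g : {dot V for idfun}).
Local Open Scope lfun_scope.
Implicit Types J K L B : 'End(V).

(** Both distributions of the theorem have this form, with [L] the identity
    for the first one and [L = J] for the second one. *)
Definition bracket_dist L (M : 'End(V) -> 'End(V)) K : set 'End(V) :=
  [set C | exists B, [/\ C = comm_end B K, so_end g B, L \o B = B \o L &
                         supported_on (M K) B]].

Lemma so_anti_bracket K B : twistor g K -> so_end g B ->
  so_anti g K (comm_end B K).
Proof.
move=> TK sB; have [K2 _] := TK; split.
  apply/so_endP; rewrite /comm_end opprD opprK [X in adjoint_pair _ _ X]addrC.
  have := (so_endP g B).1 sB; have := twistor_adjoint TK => aK aB.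
  apply: adjoint_pairD.
    have := adjoint_pair_comp aB aK; by rewrite comp_lfunNl comp_lfunNr opprK.
  apply: adjoint_pairN.
  have := adjoint_pair_comp aK aB; by rewrite comp_lfunNl comp_lfunNr opprK.
rewrite /anticomm_end /comm_end comp_lfunDl comp_lfunDr comp_lfunNl comp_lfunNr.
rewrite !comp_lfunA K2 -!comp_lfunA K2 comp_lfunNl comp_lfunNr comp_lfun1l comp_lfun1r.
by rewrite opprK addrA subrK addNr.
Qed.

(** An endomorphism [C] anticommuting with [K] is the bracket of [- 1/2 C K]
    with [K]. *)
Lemma dist_bracketE K M P : twistor g K -> projection_along P (M K) ->
  P \o K = K \o P -> dist g M K = bracket_dist \1 M K.
Proof.
move=> TK PM PK; have [K2 _] := TK; apply/seteqP; split=> C.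
  move=> [[sC CK] /(supported_onP PM)[CP PC]].
  have KC : K \o C = - (C \o K).
    by apply/eqP; rewrite -addr_eq0 addrC; apply/eqP.
  exists ((- 2^-1) *: (C \o K))%R; split.
  - rewrite /comm_end -comp_lfunZl -comp_lfunZr -comp_lfunA K2 comp_lfunA KC.
    rewrite comp_lfunNl -comp_lfunA K2 comp_lfunNr comp_lfun1r opprK.
    have half : 2^-1%R + 2^-1%R = 1 :> R by lra.
    by rewrite scalerN !scaleNr !opprK -scalerDl half scale1r.
  - apply/so_endP; rewrite -scalerN; apply: adjoint_pairZ.
    have := adjoint_pair_comp ((so_endP g C).1 sC) (twistor_adjoint TK).
    by rewrite comp_lfunNl comp_lfunNr opprK KC.
  - by rewrite comp_lfun1l comp_lfun1r.
  apply/(supported_onP PM); split.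
    by rewrite -comp_lfunZl -comp_lfunA -PK comp_lfunA CP.
  by rewrite -comp_lfunZr comp_lfunA PC.
move=> [B [-> sB _ /(supported_onP PM)[BP PB]]]; split.
  exact: so_anti_bracket.
apply/(supported_onP PM); rewrite /comm_end comp_lfunDl comp_lfunDr.
rewrite comp_lfunNl comp_lfunNr !comp_lfunA PB PK -!comp_lfunA BP PB -PK.
by rewrite !comp_lfunA BP.
Qed.

Lemma dist_u_bracketE K J M : twistor g K ->
  dist_u g J M K = bracket_dist J M K.
Proof.
move=> TK; apply/seteqP; split=> C.
  move=> [B [-> _ [sB BJ] Bs]]; exists B; split=> //.
  by apply/esym/subr0_eq.
move=> [B [-> sB JB Bs]]; exists B; split=> //; first exact: so_anti_bracket.
by split=> //; rewrite /comm_end JB subrr.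
Qed.

Section Leaves.
Variables (J L : 'End(V)) (k : nat) (s : 'End(V) -> 'End(V)).
Hypothesis TJ : twistor g J.
Hypothesis sJ : basic_section J s.

Definition section_end (c : 'I_k.+1 -> R) K : 'End(V) :=
  poly_end c (anticomm_end J K) \o s K.

Lemma section_end_swap c K : twistor g K ->
  section_end c K = s K \o poly_end c (anticomm_end J K).
Proof.
move=> [K2 _]; apply/esym/poly_end_comm/esym; have [J2 _] := TJ.
have [AJ AK] := anticomm_commJ K2 J2.
by apply: basic_section_comm sJ _ _ _ _; apply/esym.
Qed.

(** [QS] is self-adjoint or skew, and intertwines [J] and [K] with
    endomorphisms commuting with [Q]. *)
Lemma section_end_projection c K : twistor g K ->
  exists P, [/\ projection_along P (section_end c K),
                P \o J = J \o P & P \o K = K \o P].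
Proof.
move=> TK; have [K2 _] := TK; have [J2 _] := TJ.
have [e se] := basic_section_adjoint sJ TJ TK.
have cap0 : (limg (section_end c K) :&: lker (section_end c K) = 0)%VS.
  apply: (@adjoint_ker_img _ _ g _ e).
  rewrite {2}section_end_swap // comp_lfunZl; apply: adjoint_pair_comp => //.
  exact/adjoint_pair_poly_end/adjoint_pair_anticomm.
have [P PM] := projection_along_exists cap0; exists P.
have PZ Z : Z = J \/ Z = K -> P \o Z = Z \o P.
  move=> ZJK; have [T [T' [ZT TZ TA]]] := basic_section_intertwine sJ J2 K2 ZJK.
  have [AJ AK] := anticomm_commJ K2 J2.
  have ZA : Z \o anticomm_end J K = anticomm_end J K \o Z by case: ZJK => ->.
  apply: (projection_comm PM (T := T) (T' := T')); rewrite /section_end.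
    by rewrite comp_lfunA poly_end_comm // -comp_lfunA ZT comp_lfunA.
  by rewrite -comp_lfunA TZ comp_lfunA -poly_end_comm // comp_lfunA.
by split=> //; apply: PZ; [left | right].
Qed.

(** [section_end c K] agrees with [section_end c K0], hence vanishes, on the
    kernel of [P]; commuting with [P], it preserves the image of [P]. *)
Lemma section_end_stable c K0 K P :
  projection_along P (section_end c K0) ->
  P \o J = J \o P -> P \o K0 = K0 \o P -> P \o K = K \o P ->
  K \o (\1 - P) = K0 \o (\1 - P) ->
  lker (section_end c K + (\1 - P)) == 0%VS ->
  projection_along P (section_end c K).
Proof.
move=> PM PJ PK0 PK KP; have compl_comm Z : P \o Z = Z \o P ->
    (\1 - P) \o Z = Z \o (\1 - P).
  move=> PZ; rewrite comp_lfunDl comp_lfunDr comp_lfunNl comp_lfunNr PZ.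
  by rewrite comp_lfun1l comp_lfun1r.
have MP0 : section_end c K \o (\1 - P) = 0.
  rewrite -(projection_compl0 PM) /section_end.
  have AP : (\1 - P) \o anticomm_end J K0 = anticomm_end J K0 \o (\1 - P).
    by apply: anticomm_comm; exact: compl_comm.
  have sP : (\1 - P) \o s K0 = s K0 \o (\1 - P).
    by apply: basic_section_comm sJ _ _ _ _; exact: compl_comm.
  rewrite -!comp_lfunA.
  rewrite (basic_section_fixed sJ (compl_comm _ PJ) (compl_comm _ PK0) KP).
  rewrite -sP !comp_lfunA; congr (_ \o _); apply: poly_end_fixed => //.
  by apply: anticomm_fixed => //; exact: compl_comm.
have MP : section_end c K \o P = section_end c K.
  apply/eqP; rewrite -subr_eq0 -oppr_eq0 opprB; apply/eqP.
  by rewrite -MP0 comp_lfunDr comp_lfunNr comp_lfun1r.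
apply: projection_along_stable => //; first exact: PM.
rewrite -[RHS]MP /section_end comp_lfunA.
rewrite (poly_end_comm c (anticomm_comm PJ PK)) -!comp_lfunA; congr (_ \o _).
exact: (basic_section_comm sJ).
Qed.

Lemma section_end_continuous c (T : topologicalType) (f : T -> 'End(V)) x :
  {for x, continuous f} -> {for x, continuous (fun y => section_end c (f y))}.
Proof.
move=> fc; apply: continuous_comp_lfun; last exact: (basic_section_continuous sJ).
exact/poly_end_continuous/anticomm_continuous.
Qed.

(** The integral submanifold is the image of a small ball under
    [cayley_orbit X K0], with [X] ranging over a complement [m] of the
    centralizer of [K0] in the Lie algebra [gg]. *)
Lemma bracket_dist_integrable (a : 'I_k.+1 -> 'End(V) -> R) :
  (forall i, smooth_fun (twistor g) (a i)) ->
  (forall i K C, twistor g K -> bracket_dist L s K C ->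
     dir_deriv (twistor g) (a i) K C 0) ->
  integrable (twistor g)
    (bracket_dist L (fun K => section_end (a ^~ K) K)).
Proof.
move=> a_smooth da0 K0 TK0.
pose c i := a i K0.
have [P [PM PJ PK0]] := section_end_projection c TK0.
have [gg ggP] : exists gg : {vspace 'End(V)}, forall B, B \in gg <->
    [/\ so_end g B, L \o B = B \o L, B \o P = B & P \o B = B].
  apply: (vspace_of_closed (D := [set B | [/\ so_end g B, L \o B = B \o L,
     B \o P = B & P \o B = B]])).
    split; rewrite ?comp_lfun0l ?comp_lfun0r //.
    by move=> x y; rewrite !zero_lfunE linear0l linear0r oppr0.
  move=> t A B [sA LA AP PA] [sB LB BP PB].
  split; rewrite ?comp_lfunDl ?comp_lfunDr -?comp_lfunZl -?comp_lfunZr;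
    rewrite ?LA ?LB ?AP ?PA ?BP ?PB //.
  apply/so_endP; rewrite opprD -scalerN.
  by apply: adjoint_pairD; [apply: adjoint_pairZ | ]; apply/so_endP.
pose adK0 : 'End('End(V)) := linfun (bracket K0).
pose m := (gg :\: lker adK0)%VS.
pose X : {linear 'rV[R]_(\dim m) -> 'End(V)} := @basis_comb _ _ m.
have Xgg u : X u \in gg by apply: (subvP (diffvSl gg (lker adK0))); exact: basis_comb_mem.
have soX u : so_end g (X u) by have [] := (ggP _).1 (Xgg u).
pose f := cayley_orbit X K0.
have f_smooth : smooth_on setT f := cayley_orbit_smooth K0 soX.
have df u w : 'd f u w = comm_end (2%:R *: (res (X u) \o X w \o res (- X u))) (f u).
  by rewrite (@diff_val _ _ _ _ _ _ _ (is_diff_cayley_orbit K0 soX u)).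
have f0 : f 0 = K0 := cayley_orbit0 K0 soX.
have Tf u : twistor g (f u) := cayley_orbit_twistor soX u TK0.
have LX u : L \o X u = X u \o L by have [] := (ggP _).1 (Xgg u).
have XP u : X u \o P = X u by have [] := (ggP _).1 (Xgg u).
have PX u : P \o X u = X u \o P by have [_ _ -> ->] := (ggP _).1 (Xgg u).
have gg_sandwich A A' B : adjoint_pair g A A' ->
    L \o A = A \o L -> L \o A' = A' \o L ->
    P \o A = A \o P -> P \o A' = A' \o P -> B \in gg -> A \o B \o A' \in gg.
  move=> AA' LA LA' PA PA' /ggP[sB LB BP PB]; apply/ggP; split.
  - apply/so_endP; have := adjoint_pair_comp (adjoint_pair_comp AA' ((so_endP g B).1 sB))
      (adjoint_pair_sym AA').
    by rewrite comp_lfunNl comp_lfunNr comp_lfunA.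
  - by rewrite !comp_lfunA LA -[A \o L \o B]comp_lfunA LB -!comp_lfunA LA'.
  - by rewrite -comp_lfunA -PA' comp_lfunA -[A \o B \o P]comp_lfunA BP.
  - by rewrite !comp_lfunA PA -[A \o P \o B]comp_lfunA PB.
have commN Z u : Z \o X u = X u \o Z -> Z \o (- X u) = (- X u) \o Z.
  by move=> ZX; rewrite comp_lfunNl comp_lfunNr ZX.
have df_gg u w : 2%:R *: (res (X u) \o X w \o res (- X u)) \in gg.
  apply/memvZ/gg_sandwich => //; first exact: adjoint_pair_res.
  - exact: (res_comm (soX u)).
  - exact: (res_comm (so_endN (soX u)) (commN _ _ (LX u))).
  - exact: (res_comm (soX u)).
  - exact: (res_comm (so_endN (soX u)) (commN _ _ (PX u))).
have Pf u : P \o f u = f u \o P by exact: (cayley_orbit_comm soX).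
have fP u : f u \o (\1 - P) = K0 \o (\1 - P).
  apply: (cayley_orbit_fixed soX).
    by rewrite comp_lfunDr comp_lfunNr XP comp_lfun1r subrr.
  by rewrite comp_lfunDl comp_lfunDr comp_lfunNl comp_lfunNr PK0 comp_lfun1l comp_lfun1r.
have f_diff u : differentiable f u by have [fd _] := f_smooth 1; exact: fd.
(* as long as section_end c (f u) + 1 - P is invertible, the image and the
   kernel of section_end c (f u) are those at K0 *)
have [r1 r10 r1P] : exists2 r : R, 0 < r & forall u, ball (0 : 'rV[R]_(\dim m)) r u ->
    projection_along P (section_end c (f u)).
  have Hc : {for (0 : 'rV[R]_(\dim m)),
      continuous (fun u => section_end c (f u) + (\1 - P))}.
    apply: (@continuousD _ _ _ (fun u => section_end c (f u)) (fun=> \1 - P)).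
      exact/section_end_continuous/differentiable_continuous.
    exact: cst_continuous.
  have [|r r0 rP] := near_unit Hc; first by rewrite f0; exact: projection_unit PM.
  by exists r => // u /rP; exact: section_end_stable PM PJ PK0 (Pf u) (fP u).
have df0_inj : injective ('d f 0).
  apply: (raddf_inj (f := 'd f 0)) => w.
  have so0 : so_end g (0 : 'End(V)) by have := soX 0; rewrite linear0.
  have res0 : res (0 : 'End(V)) = \1.
    by rewrite -[LHS]comp_lfun1r (res_fixed so0) // comp_lfun0l.
  rewrite /= df f0 linear0 oppr0 res0 comp_lfun1l comp_lfun1r => Xw0.
  have Xwk : X w \in lker adK0.
    rewrite memv_ker lfunE; move: Xw0; rewrite -[LHS]/(bracket K0 _).
    by rewrite linearZ /= => /eqP; rewrite scaler_eq0 pnatr_eq0.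
  apply: basis_comb_eq0; apply/eqP; rewrite -memv0 -(capv_diff gg (lker adK0)).
  by rewrite memv_cap Xwk andbT; exact: basis_comb_mem.
have [r0 r00 [e e0 f_exp]] := immersion_expands f_smooth df0_inj.
pose r := Num.min r0 r1.
have r_gt0 : 0 < r by rewrite lt_min r00 r10.
have rr0 (u : 'rV[R]_(\dim m)) : ball 0 r u -> ball 0 r0 u.
  by apply: le_ball; rewrite ge_min lexx.
have rr1 (u : 'rV[R]_(\dim m)) : ball 0 r u -> ball 0 r1 u.
  by apply: le_ball; rewrite ge_min lexx orbT.
have {}f_exp (u v : 'rV[R]_(\dim m)) : ball 0 r u -> ball 0 r v ->
    `|u - v| <= e * `|f u - f v|.
  by move=> /rr0 ur /rr0 vr; exact: f_exp.
(* the image at f v is contained in that of s (f v), so the velocities of f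
   lie in the distribution of s, where the coefficients do not vary *)
have a_cst (u : 'rV[R]_(\dim m)) : ball 0 r u -> (fun i => a i (f u)) = c.
  move=> ur; apply/funext => i; rewrite /c -f0.
  apply: (dir_deriv0_cst (a_smooth i) f_diff _ _ ur) => // v w /rr1 /r1P PMv.
  apply: da0 => //; rewrite df.
  have [sB LB BP PB] := (ggP _).1 (df_gg v w).
  exists (2%:R *: (res (X v) \o X w \o res (- X v))); split=> //.
  by apply: (supported_on_factor PMv _ (section_end_swap c (Tf v)) BP PB).
exists (f @` ball 0 r); first by exists 0; [exact: ballxx | exact: f0].
split; first by move=> _ [u _ <-].
  by exists (\dim m); exact: embedded_ball_submanifold f_smooth e0 f_exp.
move=> _ [u ur <-]; rewrite (embedded_ball_tangent f_smooth e0 f_exp ur).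
have PMu := r1P u (rr1 u ur).
rewrite [RHS]/bracket_dist /= (a_cst u ur); apply/seteqP; split=> [_ [w _ <-]|].
  have [sB LB BP PB] := (ggP _).1 (df_gg u w).
  exists (2%:R *: (res (X u) \o X w \o res (- X u))); split=> //.
  exact/(supported_onP PMu).
move=> _ [B [-> sB LB /(supported_onP PMu)[BP PB]]].
have Bgg : B \in gg by exact/ggP.
pose conj : 'End('End(V)) := linfun (sandwich (cayley (X u)) (cayley (- X u))).
pose D := (conj @: (adK0 @: gg))%VS.
(* D has at most the dimension of m, and contains both the distribution at
   f u and the range of the differential, which has the dimension of m *)
have inD B' : B' \in gg -> comm_end B' (f u) \in D.
  move=> B'gg; rewrite (comm_cayley_orbit K0 soX).
  have -> : cayley (X u) \o comm_end (cayley (- X u) \o B' \o cayley (X u)) K0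
      \o cayley (- X u) = conj (adK0 (cayley (- X u) \o B' \o cayley (X u))).
    by rewrite !lfunE.
  apply/memv_img/memv_img/gg_sandwich => //.
  - exact/adjoint_pair_sym/adjoint_pair_cayley.
  - exact: (cayley_comm (so_endN (soX u)) (commN _ _ (LX u))).
  - exact: (cayley_comm (soX u)).
  - exact: (cayley_comm (so_endN (soX u)) (commN _ _ (PX u))).
  - exact: (cayley_comm (soX u)).
have dfD : (limg (linfun ('d f u)) <= D)%VS.
  by apply/subvP => _ /memv_imgP[w _ ->]; rewrite lfunE df inD.
have dimD : (\dim D <= \dim m)%N.
  have dim_img (U : {vspace 'End(V)}) (h : 'End('End(V))) : (\dim (h @: U) <= \dim U)%N.
    by rewrite -(limg_ker_dim h U) leq_addl.
  by rewrite (leq_trans (dim_img _ _)) // -limg_ker_compl dim_img.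
have dim_df : \dim (limg (linfun ('d f u))) = \dim m.
  rewrite limg_dim_eq; first by rewrite dimvf /dim /= mul1n.
  apply/eqP; rewrite capfv; apply/lker0P => v w; rewrite !lfunE.
  exact: (embedded_ball_diff_inj f_smooth e0 f_exp ur).
have : comm_end B (f u) \in limg (linfun ('d f u)).
  have /eqP -> : limg (linfun ('d f u)) == D by rewrite eqEdim dfD dim_df dimD.
  exact: inD.
by move=> /memv_imgP[w _ ->]; exists w; rewrite ?lfunE.
Qed.

End Leaves.
End Distributions.

Section Reduction.
Context {R : realType} {V : vectType R} (g : {dot V for idfun}).

Lemma integrable_eq (E : normedModType R) (M : set E) (D D' : E -> set E) :
  (forall x, M x -> D x = D' x) -> integrable M D' -> integrable M D.
Proof.
move=> DD' iD x Mx; have [N Nx [NM Nsub Ntan]] := iD x Mx.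
exists N => //; split=> // y Ny; rewrite Ntan //.
by rewrite DD' //; exact: NM.
Qed.

(** The splitting needed by [dist_bracketE] holds for [QS], and for [S] alone
    as the case of a constant polynomial. *)
Lemma dist_section_endE J k (s : 'End(V) -> 'End(V)) (c : 'I_k.+1 -> R) M K :
  twistor g J -> basic_section J s -> twistor g K ->
  M K = section_end J s c K -> dist g M K = bracket_dist g \1%VF M K.
Proof.
move=> TJ sJ TK MK; have [P [PM _ PK]] := section_end_projection TJ sJ c TK.
by apply: dist_bracketE PK => //; rewrite MK.
Qed.

End Reduction.

Theorem theorem5p9 (R : realType) (n : nat) (V : vectType R)
    (g : {dot V for idfun}) (J : 'End(V)) (k : nat)
    (a : 'I_k.+1 -> 'End(V) -> R) (Q S : 'End(V) -> 'End(V))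
    (dimV : \dim {:V} = (2 * n)%N) (dimV_ge4 : (4 <= \dim {:V})%N)
    (TJ : twistor g J)
    (a_smooth : forall i, smooth_fun (twistor g) (a i))
    (Q_def : forall K, twistor g K ->
       Q K = \sum_(i < k.+1) a i K *: exp_end (anticomm_end J K) i)
    (S_def : [\/ (forall K, twistor g K -> S K = \1%VF),
                 (forall K, twistor g K -> S K = J + K),
                 (forall K, twistor g K -> S K = J - K)
               | (forall K, twistor g K -> S K = comm_end J K)]) :
  ((forall i K B, twistor g K -> dist g S K B ->
      dir_deriv (twistor g) (a i) K B 0) ->
    integrable (twistor g) (dist g (fun K => (Q K \o S K)%VF))) /\
  ((forall i K C, twistor g K -> dist_u g J S K C ->
      dir_deriv (twistor g) (a i) K C 0) ->
    integrable (twistor g) (dist_u g J (fun K => (Q K \o S K)%VF))).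
Proof.
have [s [sJ sE]] : exists s, basic_section J s /\
    forall K, twistor g K -> S K = s K.
  case: S_def => SE.
  - by exists (fun=> \1%VF); split=> //; constructor 1.
  - by exists (fun K => J + K); split=> //; constructor 2.
  - by exists (fun K => J - K); split=> //; constructor 3.
  - by exists (comm_end J); split=> //; constructor 4.
have QSE K : twistor g K -> (Q K \o S K)%VF = section_end J s (a ^~ K) K.
  by move=> TK; rewrite Q_def // sE.
have sectionE (L : 'End(V)) K : twistor g K ->
    bracket_dist g L (fun K => (Q K \o S K)%VF) K =
    bracket_dist g L (fun K => section_end J s (a ^~ K) K) K.
  by move=> TK; rewrite /bracket_dist (QSE _ TK).
have sSE (L : 'End(V)) K : twistor g K -> bracket_dist g L s K = bracket_dist g L S K.
  by move=> TK; rewrite /bracket_dist (sE _ TK).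
split=> da0.
  apply: (integrable_eq (D' := bracket_dist g \1%VF
    (fun K => section_end J s (a ^~ K) K))) => [K TK|].
    by rewrite (dist_section_endE TJ sJ TK (QSE K TK)) sectionE.
  apply: bracket_dist_integrable => // i K B TK; rewrite sSE // => KB; apply: da0 => //.
  (* [S] is the section with constant coefficient polynomial 1 *)
  rewrite (dist_section_endE TJ sJ TK (c := fun _ : 'I_1 => 1)) //.
  rewrite /section_end /poly_end big_ord1 scale1r /exp_end /= comp_lfun1l.
  exact: sE.
apply: (integrable_eq (D' := bracket_dist g J
  (fun K => section_end J s (a ^~ K) K))) => [K TK|].
  by rewrite dist_u_bracketE // sectionE.
apply: bracket_dist_integrable => // i K C TK; rewrite sSE // => KC; apply: da0 => //.
by rewrite dist_u_bracketE.
Qed.
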